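(* Let $n,k$ be positive integers, let $\lambda,\mu,\nu\in\Pi^{(n,k)}$, and suppose that $\mu$ is a two-column partition ($\mu_1=2$) with $\ell(\mu)<n$. Then $$N_{\lambda\mu}^{(k)\nu}=\sharp\{\text{paths } P=P_1*P_2 \text{ from }\lambda\text{ to }\nu \text{ in } \mathcal P^{(n,k)}_{(\mu')} \text{ that fit } \mu \text{ and satisfy } T_P\in CSF_k(\mu)\},$$ that is, $N_{\lambda\mu}^{(k)\nu}$ is the number of paths in $\mathcal P^{(n,k)}_{(\mu')}$ from $\lambda$ to $\nu$ that fit $\mu$ and do not belong to the set $\mathcal D_2$.
   Context: **Restricted partitions and fusion coefficients.** $\ell(\lambda)$ is the number of nonzero parts of a partition $\lambda$, and $\mu'$ is the conjugate of $\mu$. A partition $\lambda$ is $(n,k)$-restricted if $\ell(\lambda)\le n$ and $0\le\lambda_1-\lambda_n\le k$ (with $\lambda_j=0$ for $j>\ell(\lambda)$); $\Pi^{(n,k)}$ is the set of these partitions. Let $J^{(n,k)}$ be the ideal of $\mathbb Q[x_1,\dots,x_n]^{S_n}$ generated by the Schur polynomials $s_\lambda$ with $\ell(\lambda)\le n$ and $\lambda_1-\lambda_n=k+1$. The images of $s_\lambda$, $\lambda\in\Pi^{(n,k)}$, form a linear basis of $\mathbb Q[x_1,\dots,x_n]^{S_n}/J^{(n,k)}$. The $sl(n)$ level $k$ fusion coefficients are defined, for $\lambda,\mu\in\Pi^{(n,k)}$, by $s_\lambda s_\mu=\sum_{\nu\in\Pi^{(n,k)}}N_{\lambda\mu}^{(k)\nu}s_\nu$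 in this quotient. (Imposing also $s_{(1^n)}=1$ gives the fusion algebra.) **Paths and labels.** The diagram of $\lambda$ is the set of boxes $(i,j)$, $1\le i\le\lambda_j$, where $i$ is the column and $j$ the row (row 1 is at the bottom). The label of the box $(i,j)$ is $i-j$. A path from $\lambda$ to $\nu$ is a chain of partitions $\lambda=\lambda^{(0)}\subset\lambda^{(1)}\subset\cdots\subset\lambda^{(m)}=\nu$, each obtained from the preceding one by adding one box; $m=|P|$ is its length. It is decreasing if the labels of the successively added boxes strictly decrease. $P=P_1*P_2$ denotes the concatenation of a path $P_1$ from $\lambda$ to a partition $\eta$ and a path $P_2$ from $\eta$ to $\nu$. $\mathcal P^{(n,k)}_{(\mu')}$ is the set of paths $P=P_1*P_2$ from $\lambda$ to $\nu$ with $P_1,P_2$ decreasing, $|P_1|=\mu_1'$, $|P_2|=\mu_2'$, and $\lambda,\eta,\nu\in\Pi^{(n,k)}$ (the other partitions in the chain need not be restricted). For such $P$, the tableau $T_P$ of shape $\mu$ has as its $i$-th column, read top to bottom, the sequence of labels of $P_i$ (columns bottom-justified). $P$ fits $\mu$, written $T_P\in CS(\mu)$ ($T_P$ is column strict), if columns strictly increase from bottom to top and rows weakly increase from left to right; i.e. for each $j=1,\dots,\mu'_2$ the $j$-th smallest label of $P_1$ is at most the $j$-th smallest label of $P_2$. **Words and pairing.** The word $w$ of $P=P_1*P_2$ is the sequence of the labels of all boxes of $\nu/\lambda$ sorted in weakly increasing order, where if a label occurs both in $P_1$ and in $P_2$ the occurrence from $P_1$ comes first. Replace each letter coming from $P_1$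 by a left parenthesis and each letter coming from $P_2$ by a right parenthesis. A letter is paired if its parenthesis is matched under the usual rule of parenthesization, otherwise unpaired. A path $P_i$ has a $\bot$-label if it adds a box in row $1$, and a $\top$-label if it adds a box in row $n$; $\bot$ and $\top$ denote these labels. **The sets $\mathcal D_2$ and $CSF_k(\mu)$.** $\mathcal D_2$ is the set of paths $P=P_1*P_2\in\mathcal P^{(n,k)}_{(\mu')}$ from $\lambda$ to $\nu$ such that: (0) $\nu_1-\nu_n=k$; (1) $T_P\in CS(\mu)$; (2) $P_1$ has a $\top$-label and $P_2$ does not, and exactly one of $P_1,P_2$ has a $\bot$-label; (3) let $a_1<a_2<\dots<a_s$ be the labels of the boxes of $\nu/\lambda$ in the last column (column $\nu_1$) of $\nu$ (regarded as letters of $w$); at least one of these boxes is added by $P_2$; letting $a_{i_0}$ be the largest of the $a_i$ whose box is added by $P_2$, the letter $a_{i_0}$ is not paired with the letter $a_1-1$ (when the label $a_1-1$ occurs in $w$; it is then the label of the box immediately to the left of the box of $a_1$); (4) the letter $\top$ (the smallest letter of $w$) is either unpaired or paired with the letter $a_{i_0}$. The $k$-fusion tableaux are $CSF_k(\mu)=CS(\mu)\setminus\mathcal D_2$, meaning the tableaux $T_P\in CS(\mu)$ of paths $P$ (from $\lambda$ to $\nu$) with $P\notin\mathcal D_2$. *)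

(* Defs.v *)
From Stdlib Require Import ClassicalEpsilon.
From mathcomp Require Import all_boot all_order all_algebra.
From mathcomp Require Export mpoly.

Set Implicit Arguments.
Unset Strict Implicit.
Unset Printing Implicit Defensive.

Import GRing.Theory.
Local Open Scope ring_scope.

(* A partition is the list of its nonzero parts, so [size lam] is the length
   of [lam]; parts are indexed from 1 and vanish beyond the length. *)
Definition is_part (lam : seq nat) : bool :=
  sorted geq lam && (0%N \notin lam).

Definition part (lam : seq nat) (j : nat) : nat := nth 0%N lam j.-1.

Definition conj_part (lam : seq nat) (i : nat) : nat :=
  count (fun x => (i <= x)%N) lam.

Definition restricted (n k : nat) (lam : seq nat) : bool :=
  [&& is_part lam, (size lam <= n)%N & (part lam 1 - part lam n <= k)%N].

(* det (x_i ^ (lam_j + n - j)) for i, j = 1, ..., n; the code shifts i and j to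
   start from 0. *)
Definition alternant (n : nat) (lam : seq nat) : {mpoly rat[n]} :=
  \det (\matrix_(i < n, j < n) ('X_i ^+ (nth 0%N lam j + (n - j.+1)))).

(* The Schur polynomial is the quotient of the alternant of [lam] by the
   Vandermonde determinant; this quotient is unique since {mpoly rat[n]} is an
   integral domain, and it exists for every partition with at most [n] parts. *)
Definition schur (n : nat) (lam : seq nat) : {mpoly rat[n]} :=
  epsilon (inhabits 0)
    (fun p : {mpoly rat[n]} => p * alternant n [::] = alternant n lam).

Definition fusion_generator (n k : nat) (lam : seq nat) : bool :=
  [&& is_part lam, (size lam <= n)%N & part lam 1 - part lam n == k.+1]%N.

(* An ideal of the ring of symmetric polynomials: the multipliers are symmetric. *)
Definition fusion_ideal (n k : nat) (p : {mpoly rat[n]}) : Prop :=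
  exists2 l : seq ({mpoly rat[n]} * seq nat),
    all (fun gl => (gl.1 \is symmetric) && fusion_generator n k gl.2) l
  & p = \sum_(gl <- l) gl.1 * schur n gl.2.

(* [c] is the finitely supported family of coordinates of the class of [p] on
   the basis of the classes of the [schur n nu], for [nu] restricted. *)
Definition fusion_expansion (n k : nat) (p : {mpoly rat[n]})
    (c : seq nat -> rat) : Prop :=
  exists s : seq (seq nat),
    [/\ uniq s, all (restricted n k) s,
        forall nu, nu \notin s -> c nu = 0
      & fusion_ideal k (p - \sum_(nu <- s) c nu *: schur n nu)].

Definition fusion_coef (n k : nat) (lam mu nu : seq nat) : rat :=
  epsilon (inhabits (fun=> 0))
    (fusion_expansion k (schur n lam * schur n mu)) nu.

(* Boxes are pairs (column, row), both counted from 1. *)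
Definition label (b : nat * nat) : int := b.1%:Z - b.2%:Z.

Definition adds_box (la mu : seq nat) : bool :=
  [&& is_part la, is_part mu
    & has (fun j => mu == incr_nth la j) (iota 0 (size la).+1)].

Definition added_box (la mu : seq nat) : nat * nat :=
  let j := (find (fun j => (part la j < part mu j)%N) (iota 1 (size mu))).+1 in
  (part mu j, j).

(* A chain lam = lam^(0), lam^(1), ..., lam^(m) is given by [lam] and the
   sequence [:: lam^(1); ...; lam^(m)]. *)
Definition boxes (lam : seq nat) (p : seq (seq nat)) : seq (nat * nat) :=
  pairmap added_box lam p.

Definition labels (lam : seq nat) (p : seq (seq nat)) : seq int :=
  map label (boxes lam p).

Definition decreasing (lam : seq nat) (p : seq (seq nat)) : bool :=
  sorted (fun x y : int => y < x) (labels lam p).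

(* A concatenation P_1 * P_2 starting at [lam] is given by the pair of its
   factors; the intermediate partition eta is the end of P_1. *)
Definition cpath : Type := (seq (seq nat) * seq (seq nat))%type.

Definition mid (lam : seq nat) (P : cpath) : seq nat := last lam P.1.

Definition boxes1 (lam : seq nat) (P : cpath) := boxes lam P.1.
Definition boxes2 (lam : seq nat) (P : cpath) := boxes (mid lam P) P.2.
Definition labels1 (lam : seq nat) (P : cpath) := labels lam P.1.
Definition labels2 (lam : seq nat) (P : cpath) := labels (mid lam P) P.2.

Definition in_paths (n k : nat) (lam mu nu : seq nat) (P : cpath) : bool :=
  [&& path adds_box lam P.1 && path adds_box (mid lam P) P.2,
      last (mid lam P) P.2 == nu,
      decreasing lam P.1 && decreasing (mid lam P) P.2,
      size P.1 == conj_part mu 1, size P.2 == conj_part mu 2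
    & [&& restricted n k lam, restricted n k (mid lam P)
        & restricted n k nu]].

(* The two columns of the tableau of [P], each listed from bottom to top. *)
Definition tableau (lam : seq nat) (P : cpath) : seq int * seq int :=
  (rev (labels1 lam P), rev (labels2 lam P)).

Definition column_strict (mu : seq nat) (T : seq int * seq int) : bool :=
  [&& size T.1 == conj_part mu 1, size T.2 == conj_part mu 2,
      sorted (fun x y : int => x < y) T.1, sorted (fun x y : int => x < y) T.2
    & all (fun j => T.1`_j <= T.2`_j) (iota 0 (conj_part mu 2))].

Definition fits (lam mu : seq nat) (P : cpath) : bool :=
  column_strict mu (tableau lam P).

(* The flag of a letter is [true] when it comes from P_1 (a left parenthesis)
   and [false] when it comes from P_2 (a right parenthesis). *)
Definition letter : Type := (int * bool)%type.

Definition letter_le (x y : letter) : bool :=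
  (x.1 < y.1) || ((x.1 == y.1) && (y.2 ==> x.2)).

Definition word (lam : seq nat) (P : cpath) : seq letter :=
  sort letter_le ([seq (a, true) | a <- labels1 lam P] ++
                  [seq (a, false) | a <- labels2 lam P]).

(* The matched (left, right) pairs of [w], given the stack [st] of the left
   parentheses still open before [w]. *)
Fixpoint pairing (st w : seq letter) : seq (letter * letter) :=
  if w is x :: w' then
    if x.2 then pairing (x :: st) w'
    else if st is y :: st' then (y, x) :: pairing st' w'
    else pairing [::] w'
  else [::].

Definition pairs (lam : seq nat) (P : cpath) : seq (letter * letter) :=
  pairing [::] (word lam P).

Definition paired (lam : seq nat) (P : cpath) (x : letter) : bool :=
  has (fun xy => (xy.1 == x) || (xy.2 == x)) (pairs lam P).

Definition in_row (j : nat) (bs : seq (nat * nat)) : bool :=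
  has (fun b => b.2 == j) bs.

(* The labels, in increasing order, of the boxes of [bs] in column [c]. *)
Definition col_labels (c : nat) (bs : seq (nat * nat)) : seq int :=
  sort <=%R [seq label b | b <- bs & b.1 == c].

Definition in_D2 (n k : nat) (lam mu nu : seq nat) (P : cpath) : bool :=
  let B1 := boxes1 lam P in
  let B2 := boxes2 lam P in
  let a1 := head 0 (col_labels (part nu 1) (B1 ++ B2)) in
  let ai0 := (last 0 (col_labels (part nu 1) B2), false) in
  (* by [in_row n B1] below, row n of nu ends with a box added by P_1 *)
  let top := (label (part nu n, n), true) in
  [&& in_paths n k lam mu nu P,
      (part nu 1 - part nu n == k)%N,
      fits lam mu P,
      [&& in_row n B1, ~~ in_row n B2 & in_row 1 B1 (+) in_row 1 B2],
      (col_labels (part nu 1) B2 != [::]) &&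
        ~~ has (fun xy => (xy.1.1 == a1 - 1) && (xy.2 == ai0)) (pairs lam P)
    & ~~ paired lam P top || ((top, ai0) \in pairs lam P)].

Definition fusion_path (n k : nat) (lam mu nu : seq nat) : pred cpath :=
  fun P => [&& in_paths n k lam mu nu P, fits lam mu P
             & ~~ in_D2 n k lam mu nu P].

Definition has_card (T : eqType) (A : pred T) (m : nat) : Prop :=
  exists s : seq T, [/\ uniq s, s =i A & size s = m].

(* Main.v *)
From HB Require Import structures.
From Stdlib Require Import ClassicalEpsilon.
Require Import Defs.
From mathcomp Require Import all_boot all_order all_algebra.
From mathcomp Require Import all_fingroup zify ring.

Set Implicit Arguments.
Unset Strict Implicit.
Unset Printing Implicit Defensive.
Import Order.TTheory GRing.Theory Num.Theory.
Local Open Scope ring_scope.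

(** The coefficient is a difference of two numbers of chains of partitions, and
    this difference counts the paths of the statement.

    Let a >= b be the lengths of the columns of mu.  By the Pieri rule, a
    vertical strip added to a restricted partition gives either a restricted
    partition or a generator of the ideal ([fusion_pieri]).  So s_lam e_a e_b is,
    modulo the ideal, the sum of the s_nu over the chains lam, eta, nu of
    restricted partitions whose two steps are vertical strips of sizes a and b.
    Since s_mu = e_a e_b - e_(a+1) e_(b-1) ([schur_two_columns]), the coefficient
    of s_nu is the number of chains of type (a, b) minus the number of chains of
    type (a+1, b-1) ([fusion_coef_strips]).  This uses that coordinates modulo
    the ideal are unique.  Put N = n + k.  Two exponents of the alternant of a
    generator differ by N; hence the functional that adds up the coefficients of
    the monomials of a given degree with given exponents modulo N vanishes on
    the products of the ideal with the Vandermonde determinant, while it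
    separates the alternants of the restricted partitions ([expansion_coord]).

    Now fix lam and nu, and number the rows from 1 (in the code, from 0).  A row of nu / lam with two boxes gets one from each
    strip, so a chain amounts to the set J of those free rows (the rows with
    exactly one box) whose box lies in the first strip.  That eta is a partition
    means that J fills each column of free boxes from below ([admissible]).
    That eta is restricted is one more condition of this kind, relevant when the
    columns of rows 1 and n are glued together on the cylinder ([wraps]): it
    forbids that row 1 is in J and row n is not ([wrong_wrap]).  Read the free
    rows from row n to row 1, a row of J as a left parenthesis and the others as
    right parentheses.

    Without the last condition, opening the last unmatched right parenthesis is
    a bijection which shows that the admissible sets of size s exceed those of
    size s + 1 by the number of words without unmatched right parenthesis
    ([lattice_count]).  The sets that violate the last condition are counted by
    the same lemma, after deletion of row n and of the top row of the column of
    row 1 ([wrong_wrap_count]), and the lattice words that this yields correspond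
    to the [excluded] words of the original system ([excluded_count]).  The
    difference of the numbers of chains is therefore the number of lattice words
    that are not excluded ([strip_pairs_diff]).

    It remains to identify the two notions.  The word of a path is sorted by
    labels, not by rows, and contains the letters of the rows with two boxes;
    but its balance up to a label agrees with the height of a row, up to the
    contribution of one double row ([excess_height]).  Hence a path fits mu if
    and only if its row word is a lattice word ([fitsE]), and it then belongs to
    the set D_2 if and only if this word is excluded ([in_D2E]). *)

(** * Alternants and the Pieri rule *)

Definition altdet n (alpha : 'I_n -> nat) : {mpoly rat[n]} :=
  \det (\matrix_(i < n, j < n) ('X_i ^+ alpha j)).

Lemma altdet_eq0 n (alpha : 'I_n -> nat) i j :
  i != j -> alpha i = alpha j -> altdet alpha = 0.
Proof.
move=> ij e; rewrite /altdet -det_tr; apply: (determinant_alternate ij) => l.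
by rewrite !mxE e.
Qed.

Lemma eq_altdet n (alpha beta : 'I_n -> nat) : alpha =1 beta -> altdet alpha = altdet beta.
Proof. by move=> e; congr (\det _); apply/matrixP=> i j; rewrite !mxE e. Qed.

Lemma altdet_monomials n (alpha : 'I_n -> nat) :
  altdet alpha = \sum_(s : 'S_n) (-1) ^+ s * 'X_[[multinom alpha (s i) | i < n]].
Proof.
rewrite /altdet /determinant; apply: eq_bigr => s _; congr (_ * _).
by rewrite mpolyXE_id; apply: eq_bigr => i _; rewrite !mxE mnmE.
Qed.

(** Each term of the determinant is multiplied by a symmetric polynomial, so the
    index set of a monomial of e_r may be permuted along with the exponents. *)
Lemma altdet_mesym n (alpha : 'I_n -> nat) r :
  altdet alpha * mesym n rat r
  = \sum_(I : {set 'I_n} | #|I| == r) altdet (fun i => (alpha i + (i \in I))%N).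
Proof.
under [RHS]eq_bigr => I _ do rewrite altdet_monomials.
rewrite altdet_monomials exchange_big mulr_suml /=; apply: eq_bigr => s _.
have inj_s : injective (fun I : {set 'I_n} => s @^-1: I).
  move=> I J /setP e; apply/setP => i.
  by have := e ((s^-1)%g i); rewrite !inE permKV.
rewrite mesymE -mulrA -mulr_sumr; congr (_ * _).
rewrite (reindex_inj inj_s) mulr_sumr /=; apply: eq_big => [I|I _].
  by congr (_ == _); apply: on_card_preimset; apply: onW_bij; apply: injF_bij; apply: perm_inj.
rewrite -mpolyXD; congr ('X_[_]); apply/mnmP => i.
by rewrite mnmDE !mnmE inE.
Qed.

(** * Partitions and vertical strips *)

(** Rows are numbered from 0 and may exceed [n], since partitions are indexed by
    all of [nat]; rows beyond [n] belong to no strip. *)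
Definition inrow n (I : {set 'I_n}) (r : nat) : bool := r \in [seq val i | i in I].

Lemma inrowE n (I : {set 'I_n}) (i : 'I_n) : inrow I i = (i \in I).
Proof. by rewrite /inrow mem_map ?mem_enum //; apply: val_inj. Qed.

Lemma inrow_out n (I : {set 'I_n}) r : (n <= r)%N -> inrow I r = false.
Proof. by move=> h; apply/negP => /imageP[i _ e]; move: h; rewrite e leqNgt ltn_ord. Qed.

Definition trim (s : seq nat) := [seq x <- s | x != 0%N].

Lemma sorted_geq_nth (s : seq nat) i j :
  sorted geq s -> (i <= j)%N -> (nth 0 s j <= nth 0 s i)%N.
Proof.
move=> so ij; have [js|js] := ltnP j (size s); last by rewrite (nth_default _ js).
have tr : transitive geq by move=> a b c /= ? ?; lia.
apply: (sorted_leq_nth tr (fun x => leqnn x) 0%N so) => //.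
exact: leq_ltn_trans js.
Qed.

Lemma nth_trim (s : seq nat) i : sorted geq s -> nth 0%N (trim s) i = nth 0%N s i.
Proof.
elim: s i => [|x s IH] i so //=.
have so' := path_sorted so.
case: eqP => [x0|x0] /=; last by case: i => //= i; apply: IH.
have z j : nth 0%N s j = 0%N.
  by have := sorted_geq_nth (i := 0) (j := j.+1) so isT; rewrite /= x0; lia.
by rewrite IH // z; case: i => //= i; rewrite z.
Qed.

Lemma trim_part (s : seq nat) : sorted geq s -> is_part (trim s).
Proof.
move=> so; rewrite /is_part mem_filter eqxx andbT.
by apply: sorted_filter => // a b c /= ? ?; lia.
Qed.

Lemma part_nth_le lam i j : is_part lam -> (i <= j)%N -> (nth 0 lam j <= nth 0 lam i)%N.
Proof. by case/andP=> so _; apply: sorted_geq_nth. Qed.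

Lemma part_nth_gt0 lam i : is_part lam -> (0 < nth 0 lam i)%N = (i < size lam)%N.
Proof.
case/andP=> _ n0; have [h|h] := ltnP i (size lam); last by rewrite nth_default.
by rewrite lt0n; apply: contra n0 => /eqP <-; apply: mem_nth.
Qed.

Lemma part_ext lam mu : is_part lam -> is_part mu ->
  (forall i, nth 0%N lam i = nth 0%N mu i) -> lam = mu.
Proof.
move=> pl pm e; apply: (@eq_from_nth _ 0%N) => [|i _]; last exact: e.
have h i : (i < size lam)%N = (i < size mu)%N by rewrite -!part_nth_gt0 // e.
have := h (size lam); have := h (size mu); lia.
Qed.

(** Kept apart from [add_strip]: only when these parts decrease do they form a
    partition, and dropping zeros before testing this could hide an increase. *)
Definition addrows n (lam : seq nat) (I : {set 'I_n}) : seq nat :=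
  mkseq (fun r => (nth 0 lam r + inrow I r)%N) n.
Definition vstrip n lam (I : {set 'I_n}) : bool := sorted geq (addrows lam I).
Definition add_strip n lam (I : {set 'I_n}) : seq nat := trim (addrows lam I).

Lemma nth_addrows n lam (I : {set 'I_n}) r : (size lam <= n)%N ->
  nth 0%N (addrows lam I) r = (nth 0 lam r + inrow I r)%N.
Proof.
move=> sl; have [h|h] := ltnP r n; first by rewrite nth_mkseq.
by rewrite inrow_out // !nth_default ?size_mkseq //; lia.
Qed.

Lemma vstripP n lam (I : {set 'I_n}) : (size lam <= n)%N ->
  reflect (forall r, (nth 0 lam r.+1 + inrow I r.+1 <= nth 0 lam r + inrow I r)%N)
          (vstrip lam I).
Proof.
move=> sl; apply: (iffP idP) => [so r|h].
  by have := sorted_geq_nth so (leqnSn r); rewrite !nth_addrows.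
apply/(sortedP 0%N) => i _; rewrite !nth_addrows //; exact: h.
Qed.

Lemma nth_add_strip n lam (I : {set 'I_n}) r : (size lam <= n)%N -> vstrip lam I ->
  nth 0%N (add_strip lam I) r = (nth 0 lam r + inrow I r)%N.
Proof. by move=> sl v; rewrite nth_trim // nth_addrows. Qed.

Lemma add_strip_part n lam (I : {set 'I_n}) : vstrip lam I -> is_part (add_strip lam I).
Proof. exact: trim_part. Qed.

Lemma size_add_strip n lam (I : {set 'I_n}) : (size (add_strip lam I) <= n)%N.
Proof. by rewrite /add_strip /trim size_filter; apply: leq_trans (count_size _ _) _; rewrite size_mkseq. Qed.

Lemma alternantE n lam : alternant n lam = altdet (fun j : 'I_n => (nth 0 lam j + (n - j.+1))%N).
Proof. by []. Qed.

(** If the sum is not a partition, two consecutive exponents coincide and the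
    alternant vanishes. *)
Lemma alternant_mesym n lam r : is_part lam -> (size lam <= n)%N ->
  alternant n lam * mesym n rat r
  = \sum_(I : {set 'I_n} | (#|I| == r) && vstrip lam I) alternant n (add_strip lam I).
Proof.
move=> pl sl; rewrite alternantE altdet_mesym (bigID (vstrip lam)) /=.
rewrite [X in _ + X]big1 ?addr0 => [|I /andP[_ nv]].
  apply: eq_bigr => I /andP[_ v]; rewrite alternantE; apply: eq_altdet => i.
  by rewrite nth_add_strip // inrowE addnAC.
have [r' r'P] : exists r', ~~ (nth 0 lam r'.+1 + inrow I r'.+1 <= nth 0 lam r' + inrow I r')%N.
  have [/forallP h|/forallPn[i]] := boolP [forall i : 'I_n,
      (nth 0 lam i.+1 + inrow I i.+1 <= nth 0 lam i + inrow I i)%N]; last by exists i.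
  case/(vstripP _ sl): nv => r'; have [h'|h'] := ltnP r' n; first exact: (h (Ordinal h')).
  by rewrite (nth_default _ (leq_trans sl (leqW h'))) inrow_out // leqW.
have := part_nth_le pl (leqnSn r'); move: r'P.
case e1: (inrow I r'.+1); case e2: (inrow I r'); rewrite ?addn0 ?addn1; try lia.
move=> h1 h2; have lt1 : (r'.+1 < n)%N by case: ltnP e1 => // h; rewrite inrow_out.
pose i := Ordinal (ltnW lt1); pose j := Ordinal lt1.
apply: (@altdet_eq0 _ _ i j); first by rewrite -val_eqE /=; lia.
by rewrite -(inrowE I i) -(inrowE I j) /= e1 e2; lia.
Qed.

(** * Independence modulo the fusion ideal *)

Definition same_residues n N (beta m : 'X_{1..n}) : bool :=
  [forall i, m i == beta i %[mod N]] && (mdeg m == mdeg beta).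

(** The sum of the coefficients of [p] over a class of monomials for the relation
    generated by moving [N] units of exponent from one variable to another.  It is
    a functional on the quotient of the polynomial ring by the x_i^N - x_j^N. *)
Definition residue_coef n N (beta : 'X_{1..n}) (p : {mpoly rat[n]}) : rat :=
  \sum_(m : 'X_{1..n < (mdeg beta).+1} | same_residues N beta m) p@_m.

Lemma residue_coefX n N (beta m : 'X_{1..n}) : residue_coef N beta 'X_[m] = (same_residues N beta m)%:R.
Proof.
rewrite /residue_coef; case c: (same_residues N beta m).
  have hd : (mdeg m < (mdeg beta).+1)%N by case/andP: c => _ /eqP ->.
  rewrite (bigD1 (BMultinom hd)) //= mcoeffX eqxx big1 ?addr0 // => m' /andP[_ /negbTE ne].
  by rewrite mcoeffX -val_eqE eq_sym /= in ne *; rewrite ne.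
rewrite big1 // => m' c'; rewrite mcoeffX; case: eqP => // e; move: c; by rewrite e c'.
Qed.

Lemma residue_coef_is_linear n N (beta : 'X_{1..n}) : linear_for *%R (@residue_coef n N beta).
Proof.
move=> c p q; rewrite /residue_coef mulr_sumr -big_split; apply: eq_bigr => m _.
by rewrite mcoeffD mcoeffZ.
Qed.

HB.instance Definition _ n N (beta : 'X_{1..n}) :=
  GRing.isLinear.Build rat {mpoly rat[n]} rat *%R (@residue_coef n N beta)
    (@residue_coef_is_linear n N beta).

Lemma residue_coefZ n N (beta : 'X_{1..n}) c (p : {mpoly rat[n]}) :
  residue_coef N beta (c *: p) = c * residue_coef N beta p.
Proof. by rewrite /residue_coef mulr_sumr; apply: eq_bigr => m _; rewrite mcoeffZ. Qed.

Lemma mul_sign_scale n (s : 'S_n) (p : {mpoly rat[n]}) : (-1) ^+ s * p = ((-1) ^+ s : rat) *: p.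
Proof. by rewrite -mul_mpolyC rmorph_sign. Qed.

Definition shifted_exponents n lam : 'X_{1..n} := [multinom (nth 0 lam i + (n - i.+1))%N | i < n].

(** The first and the last exponent of the alternant of a generator differ by
    [n + k], so exchanging them changes signs but not classes. *)
Lemma residue_coef_generator n k (beta : 'X_{1..n}) (g : {mpoly rat[n]}) lam : fusion_generator n k lam ->
  residue_coef (n + k) beta (g * alternant n lam) = 0.
Proof.
case/and3P=> pl sl gen; case: n pl sl gen beta g => [|n] pl sl gen beta g.
  by move: gen; rewrite /part /= nth_default //; lia.
rewrite [g]mpolyE mulr_suml raddf_sum big1 // => m _.
rewrite /= -scalerAl residue_coefZ alternantE altdet_monomials.
rewrite [X in residue_coef _ _ X]mulr_sumr raddf_sum /=.
set S := (X in _ * X); suff e : S = - S.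
  have /eqP : S *+ 2 = 0 by rewrite mulr2n {2}e subrr.
  by rewrite mulrn_eq0 /= => /eqP ->; rewrite mulr0.
have n0 : n <> 0%N by move=> e; subst n; move: gen; rewrite /part /= subnn.
pose t : 'S_n.+1 := tperm ord0 ord_max.
have tneq : ord0 != ord_max :> 'I_n.+1 by rewrite -val_eqE /=; lia.
rewrite /S {1}(reindex_inj (mulIg t)) /= -sumrN; apply: eq_bigr => s _.
rewrite !mul_sign_scale -!scalerAr !residue_coefZ odd_permM odd_tperm tneq addbT signrN mulNr; congr (- (_ * _)).
rewrite -!mpolyXD !residue_coefX; congr (_%:R); congr (nat_of_bool _); congr (_ && _).
  apply: eq_forallb => i; rewrite !mnmDE !mnmE permM.
  have ld : (nth 0 lam 0 = nth 0 lam n + k.+1)%N.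
    by move: gen; rewrite /part /=; have := part_nth_le pl (leq0n n); lia.
  have E (j : 'I_n.+1) : (m i + (nth 0 lam (t j) + (n.+1 - (t j).+1))
      = m i + (nth 0 lam j + (n.+1 - j.+1)) %[mod n.+1 + k])%N.
    case: tpermP => [->|->|//] /=; rewrite ?subSS ?subn0 ?subnn ?addn0 ld.
      by rewrite -(modnDr (m i + nth 0%N lam n)); congr (_ %% _)%N; lia.
    by rewrite -(modnDr (m i + nth 0%N lam n)); congr (_ %% _)%N; lia.
  by rewrite E.
rewrite !mdegD; congr (_ + _ == _)%N; rewrite !mdegE.
have E (u : 'S_n.+1) : (\sum_(i < n.+1) [multinom (nth 0 lam (u i) + (n.+1 - (u i).+1))%N | i < n.+1] i
   = \sum_(i < n.+1) (nth 0 lam i + (n.+1 - i.+1)))%N.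
  rewrite [RHS](reindex_inj (@perm_inj _ u)) /=; apply: eq_bigr => i _; by rewrite mnmE.
by rewrite !E.
Qed.

(** An increasing permutation moves no index down, and neither does its inverse. *)
Lemma incr_perm_id n (s : 'S_n) : (forall i j : 'I_n, (i < j)%N -> (s i < s j)%N) -> s = 1%g.
Proof.
move=> mono; have ge (u : 'S_n) : (forall i j : 'I_n, (i < j)%N -> (u i < u j)%N) ->
    forall m (i : 'I_n), m = i :> nat -> (m <= u i)%N.
  move=> mu; elim=> // m IH i e; have lt : (m < n)%N by have := ltn_ord i; lia.
  have := IH (Ordinal lt) erefl; have := mu (Ordinal lt) i; rewrite /= -e; lia.
apply/permP => i; rewrite perm1; apply/val_inj/eqP; rewrite eqn_leq (ge s mono i i erefl) andbT.
have mono' (j l : 'I_n) : (j < l)%N -> ((s^-1)%g j < (s^-1)%g l)%N.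
  move=> jl; rewrite ltnNge; apply/negP; rewrite leq_eqVlt => /orP[/eqP/val_inj|/mono].
    by move/perm_inj => e; rewrite e ltnn in jl.
  by rewrite !permKV; lia.
by have := ge _ mono' (s i) (s i) erefl; rewrite permK.
Qed.

(** Exponents of restricted partitions lie in a window shorter than [n + k].  If
    one exponent had to move up by a multiple of [n + k], none could move down, and
    the degrees would differ. *)
Lemma same_residues_restricted n k lam nu (s : 'S_n) : (0 < n)%N ->
  restricted n k lam -> restricted n k nu ->
  same_residues (n + k) (shifted_exponents n nu) [multinom (nth 0 lam (s i) + (n - (s i).+1))%N | i < n] ->
  s = 1%g /\ lam = nu.
Proof.
move=> n0 /and3P[pl sl wl] /and3P[pn sn wn] /andP[/forallP c /eqP d].
pose al (j : 'I_n) := (nth 0 lam j + (n - j.+1))%N.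
pose be (j : 'I_n) := (nth 0 nu j + (n - j.+1))%N.
have win mu : is_part mu -> (part mu 1 - part mu n <= k)%N -> forall i j : 'I_n,
    (nth 0 mu i + (n - i.+1) < nth 0 mu j + (n - j.+1) + (n + k))%N.
  move=> pm; rewrite /part /= => wm i j.
  have := part_nth_le pm (leq0n i); have := ltn_ord i; have := ltn_ord j.
  have : (j <= n.-1)%N by have := ltn_ord j; lia.
  by move/(part_nth_le pm); lia.
have wal i j : (al i < al j + (n + k))%N by apply: win.
have wbe i j : (be i < be j + (n + k))%N by apply: win.
have modN x y : x = y %[mod n + k] -> (x < y)%N -> (x + (n + k) <= y)%N.
  move=> e xy; have : (n + k %| y - x)%N by rewrite -eqn_mod_dvd ?e // ltnW.
  by move/dvdn_leq; rewrite subn_gt0 => /(_ xy); lia.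
have cc i : al (s i) = be i %[mod n + k] by have := c i; rewrite !mnmE => /eqP.
have dd : (\sum_i al (s i) = \sum_i be i)%N.
  by move: d; rewrite !mdegE; under eq_bigr do rewrite mnmE; under [RHS]eq_bigr do rewrite mnmE.
have strict (f g : 'I_n -> nat) i : (forall j, f j <= g j)%N -> (f i < g i)%N ->
    (\sum_j f j < \sum_j g j)%N.
  move=> le lt; rewrite (bigD1 i) //= [ltnRHS](bigD1 i) //=.
  by rewrite -addSn; apply: leq_add; [exact: lt | apply: leq_sum => j _; apply: le].
(* A changed exponent changes by at least [n + k], which is more than the window
   of the exponents. *)
have eqs i : be i = al (s i).
  case: (ltngtP (be i) (al (s i))) => // lt; exfalso.
    have h := modN _ _ (esym (cc i)) lt.
    suff le j : (be j <= al (s j))%N by have := strict _ (fun j => al (s j)) i le lt; rewrite dd ltnn.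
    rewrite leqNgt; apply/negP => lt'; have h' := modN _ _ (cc j) lt'.
    by have := wal (s i) (s j); have := wbe j i; lia.
  have h := modN _ _ (cc i) lt.
  suff le j : (al (s j) <= be j)%N by have := strict (fun j => al (s j)) be i le lt; rewrite dd ltnn.
  rewrite leqNgt; apply/negP => lt'; have h' := modN _ _ (esym (cc j)) lt'.
  by have := wal (s j) (s i); have := wbe i j; lia.
have dec mu : is_part mu -> forall i j : 'I_n, (i < j)%N ->
    (nth 0 mu j + (n - j.+1) < nth 0 mu i + (n - i.+1))%N.
  by move=> pm i j ij; have := part_nth_le pm (ltnW ij); have := ltn_ord j; lia.
have s1 : s = 1%g.
  apply: incr_perm_id => i j ij; have := dec _ pn i j ij; rewrite -/(be i) -/(be j) !eqs.
  rewrite ltnNge => h; rewrite ltnNge; apply: contra h; rewrite leq_eqVlt => /orP[/eqP/val_inj->//|].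
  by move/(dec _ pl); rewrite -/(al (s i)) -/(al (s j)); lia.
split=> //; apply: part_ext => // i; have [lt|ge] := ltnP i n; last by rewrite !nth_default //; lia.
by have := eqs (Ordinal lt); rewrite s1 perm1 /al /be /=; lia.
Qed.

Lemma residue_coef_alternant n k lam nu : (0 < n)%N ->
  restricted n k lam -> restricted n k nu ->
  residue_coef (n + k) (shifted_exponents n nu) (alternant n lam) = (lam == nu)%:R.
Proof.
move=> n0 rl rn; rewrite alternantE altdet_monomials raddf_sum /=.
rewrite (bigD1 1%g) //= [X in _ + X]big1 ?addr0 => [|s s1].
  rewrite odd_perm1 mul1r residue_coefX; congr (nat_of_bool _)%:R; apply/idP/eqP.
    by case/(same_residues_restricted n0 rl rn).
  move=> <-; rewrite /same_residues; apply/andP; split.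
    by apply/forallP => i; rewrite !mnmE perm1.
  by apply/eqP; congr mdeg; apply/mnmP => i; rewrite !mnmE perm1.
rewrite mul_sign_scale residue_coefZ residue_coefX; case c: (same_residues _ _ _); last by rewrite mulr0.
by case/(same_residues_restricted n0 rl rn): c => e; rewrite e eqxx in s1.
Qed.

Lemma alternant0_neq0 n : alternant n [::] != 0.
Proof.
case: n => [|n]; first by rewrite /alternant det_mx00 oner_neq0.
apply/eqP => e; have r0 : restricted n.+1 0 [::] by rewrite /restricted /is_part /part /= nth_nil.
have := residue_coef_alternant (ltn0Sn n) r0 r0; rewrite e raddf0 eqxx => /eqP.
by rewrite eq_sym oner_eq0.
Qed.

(** * Existence of the Schur polynomials *)

Lemma card_initial n m : (m <= n)%N -> #|[set i : 'I_n | (i < m)%N]| = m.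
Proof.
move=> mn; rewrite -sum1_card (eq_bigl (fun i : 'I_n => (i < m)%N)) => [|i]; last by rewrite inE.
by rewrite -(big_ord_widen n (fun=> 1%N) mn) sum1_card card_ord.
Qed.

(** A set of rows closed under going down is an interval starting at 0. *)
Lemma initial_set n (I : {set 'I_n}) :
  (forall i j : 'I_n, j = i.+1 :> nat -> j \in I -> i \in I) ->
  I = [set i : 'I_n | (i < #|I|)%N].
Proof.
move=> h; have down m (i j : 'I_n) : (j + m = i)%N -> i \in I -> j \in I.
  elim: m i j => [|m IH] i j e iI.
    by have -> : j = i by apply: val_inj; rewrite /= -e addn0.
  have lt : (j + m < n)%N by have := ltn_ord i; lia.
  by apply: (IH (Ordinal lt)) => //; apply: h iI; rewrite /= -e addnS.
apply/eqP; rewrite eqEcard; apply/andP; split; last first.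
  by rewrite card_initial // -[n in leqRHS]card_ord max_card.
apply/subsetP => i iI; rewrite inE -[X in (X <= _)%N](@card_initial n) //.
apply/subset_leq_card/subsetP => j; rewrite inE ltnS => ji.
by apply: (down (i - j)%N i) => //; rewrite subnKC.
Qed.

(** The weights decrease strictly along the rows, so that moving boxes to higher
    rows lowers the weight; this is what the induction of [schur_exists] uses. *)
Definition weight n lam := (\sum_(i < n) nth 0 lam i * (n - i))%N.

(** Rows outside the interval weigh less than all rows inside it. *)
Lemma weight_initial n c (I : {set 'I_n}) : (c <= n)%N -> #|I| = c ->
  I != [set i : 'I_n | (i < c)%N] ->
  (\sum_(i in I) (n - i) < \sum_(i < n | (i < c)%N) (n - i))%N.
Proof.
move=> cn cI ne; set I0 := [set i : 'I_n | (i < c)%N] in ne.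
have -> : (\sum_(i < n | (i < c)%N) (n - i) = \sum_(i in I0) (n - i))%N by apply: eq_bigl => i; rewrite inE.
have cI0 : #|I0| = c by apply: card_initial.
rewrite (big_setID I0) [ltnRHS](big_setID I) /= setIC ltn_add2l.
have cD : #|I :\: I0| = #|I0 :\: I|.
  apply/eqP; rewrite -(eqn_add2l #|I :&: I0|) cardsID [in eqbRHS]setIC cardsID.
  by rewrite cI cI0.
have pos : (0 < #|I0 :\: I|)%N.
  rewrite lt0n -cD cards_eq0 setD_eq0; apply: contra ne => sub.
  by rewrite eqEcard sub cI cI0 leqnn.
apply: (@leq_ltn_trans (#|I :\: I0| * (n - c))%N).
  rewrite -sum_nat_const; apply: leq_sum => i; rewrite !inE -leqNgt => /andP[? _].
  exact: leq_sub2l.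
apply: (@leq_trans (#|I0 :\: I| * (n - c).+1)%N); first by rewrite cD ltn_pmul2l.
rewrite -sum_nat_const; apply: leq_sum => i; rewrite !inE => /andP[_ ic].
lia.
Qed.

Lemma weight_add_strip n lam (I : {set 'I_n}) : (size lam <= n)%N -> vstrip lam I ->
  weight n (add_strip lam I) = (weight n lam + \sum_(i in I) (n - i))%N.
Proof.
move=> sl v; rewrite /weight [X in (_ + X)%N]big_mkcond -big_split /=.
apply: eq_bigr => i _; rewrite nth_add_strip // inrowE mulnDl.
by case: (i \in I); rewrite ?mul1n ?mul0n.
Qed.

Lemma last_column n lam : is_part lam -> (size lam <= n)%N -> lam != [::] ->
  exists lam0 c, [/\ is_part lam0, (size lam0 <= n)%N, (0 < c <= n)%N,
     vstrip lam0 [set i : 'I_n | (i < c)%N]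
   & add_strip lam0 [set i : 'I_n | (i < c)%N] = lam].
Proof.
move=> pl sl ln.
pose m := nth 0%N lam 0; pose c := find (fun x => x != m) lam.
have m0 : (0 < m)%N by rewrite /m part_nth_gt0 // lt0n size_eq0.
have cn : (c <= n)%N by apply: leq_trans (find_size _ _) sl.
have lamc i : (i < c)%N = (nth 0%N lam i == m).
  apply/idP/eqP => [/(before_find 0%N)/negbFE/eqP//|e].
  rewrite ltnNge; apply/negP => ci; have [h|h] := boolP (has (fun x => x != m) lam).
    have /= := nth_find 0%N h; rewrite -/c => /eqP; apply; apply/eqP.
    by rewrite eqn_leq {1}/m part_nth_le //= -e part_nth_le.
  by move: ci; rewrite /c hasNfind // => /(nth_default 0%N); lia.
pose f r := (nth 0 lam r - (r < c))%N.
have so : sorted geq (mkseq f n).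
  apply/(sortedP 0%N) => i; rewrite size_mkseq => lt; rewrite !nth_mkseq //; last by lia.
  rewrite /f !lamc /=; have := part_nth_le pl (leqnSn i); lia.
have nthf r : nth 0%N (trim (mkseq f n)) r = f r.
  rewrite nth_trim //; have [lt|ge] := ltnP r n; first by rewrite nth_mkseq.
  by rewrite nth_default ?size_mkseq // /f nth_default //; lia.
have sf : (size (trim (mkseq f n)) <= n)%N.
  by rewrite /trim size_filter; apply: leq_trans (count_size _ _) _; rewrite size_mkseq.
have inc r : inrow [set i : 'I_n | (i < c)%N] r = (r < c)%N.
  have [lt|ge] := ltnP r n; first by rewrite (inrowE _ (Ordinal lt)) inE.
  by rewrite inrow_out //; lia.
have fK r : (f r + (r < c) = nth 0 lam r)%N.
  by rewrite /f; case h : (r < c)%N; rewrite ?subn0 ?addn0 // subnK //; move: h; rewrite lamc; lia.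
exists (trim (mkseq f n)), c.
have v : vstrip (trim (mkseq f n)) [set i : 'I_n | (i < c)%N].
  by apply/vstripP => // r; rewrite !nthf !inc !fK part_nth_le.
split=> //; first exact: trim_part.
  by rewrite cn andbT lamc.
by apply: part_ext => // [|r]; rewrite ?add_strip_part // nth_add_strip // nthf inc fK.
Qed.

(** Let lam0 be lam without its last column, of length c.  In the Pieri expansion
    of s_lam0 e_c all terms other than lam have smaller weight than lam. *)
Lemma schur_exists n lam : is_part lam -> (size lam <= n)%N ->
  exists p, p * alternant n [::] = alternant n lam.
Proof.
have [m] := ubnP (weight n lam); elim: m lam => // m IH lam lm pl sl.
have [->|ln] := eqVneq lam [::]; first by exists 1; rewrite mul1r.
have [lam0 [c [p0 s0 /andP[c0 cn] v e]]] := last_column pl sl ln.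
set I0 := [set i : 'I_n | (i < c)%N] in v e.
have w0 : (0 < \sum_(i in I0) (n - i))%N.
  rewrite (bigD1 (Ordinal (leq_trans c0 cn))) /= ?inE ?c0 //; lia.
have wl : weight n lam = (weight n lam0 + \sum_(i in I0) (n - i))%N by rewrite -e weight_add_strip.
have [q qP] := IH lam0 ltac:(lia) p0 s0.
pose P (I : {set 'I_n}) := [&& #|I| == c, vstrip lam0 I & I != I0].
have [F FP] : exists F : {set 'I_n} -> {mpoly rat[n]},
    forall I, P I -> F I * alternant n [::] = alternant n (add_strip lam0 I).
  have ex I : exists p, P I -> p * alternant n [::] = alternant n (add_strip lam0 I).
    have [/and3P[/eqP cI vI nI]|] := boolP (P I); last by exists 0.
    suff [p pP] : exists p, p * alternant n [::] = alternant n (add_strip lam0 I) by exists p.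
    apply: IH; rewrite ?add_strip_part ?size_add_strip // weight_add_strip //.
    have := weight_initial cn cI nI.
    have -> : (\sum_(i < n | (i < c)%N) (n - i) = \sum_(i in I0) (n - i))%N by apply: eq_bigl => i; rewrite inE.
    by move: lm; rewrite wl; lia.
  by exists (fun I => epsilon (inhabits 0) (fun p => P I -> p * alternant n [::] = alternant n (add_strip lam0 I)))
    => I; apply: (epsilon_spec _ _ (ex I)).
exists (q * mesym n rat c - \sum_(I | P I) F I).
rewrite mulrBl mulrAC qP alternant_mesym // mulr_suml (bigD1 I0) /=; last by rewrite v card_initial ?eqxx.
rewrite e -addrA -[RHS]addr0; congr (_ + _); apply/eqP; rewrite subr_eq0; apply/eqP.
by apply: eq_big => [I|I PI]; [rewrite /P andbA | rewrite FP // /P andbA].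
Qed.

Lemma schurE n lam : is_part lam -> (size lam <= n)%N ->
  schur n lam * alternant n [::] = alternant n lam.
Proof. by move=> pl sl; exact: (epsilon_spec _ _ (schur_exists pl sl)). Qed.

Lemma schur_eq n lam p : is_part lam -> (size lam <= n)%N ->
  p * alternant n [::] = alternant n lam -> p = schur n lam.
Proof. by move=> pl sl e; apply: (mulIf (alternant0_neq0 n)); rewrite e schurE. Qed.

Lemma schur_mesym n lam r : is_part lam -> (size lam <= n)%N ->
  schur n lam * mesym n rat r
  = \sum_(I : {set 'I_n} | (#|I| == r) && vstrip lam I) schur n (add_strip lam I).
Proof.
move=> pl sl; apply: (mulIf (alternant0_neq0 n)); rewrite mulrAC schurE // alternant_mesym //.
by rewrite mulr_suml; apply: eq_bigr => I /andP[_ v]; rewrite schurE ?add_strip_part ?size_add_strip.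
Qed.

Lemma schur0 n : schur n [::] = 1.
Proof. by apply/esym/schur_eq; rewrite ?mul1r. Qed.

(** * Two-column Schur polynomials *)

Lemma nth_column a i : nth 0%N (nseq a 1%N) i = (i < a)%N.
Proof. by rewrite nth_nseq; case: ltnP. Qed.

Lemma column_part a : is_part (nseq a 1%N).
Proof.
rewrite /is_part mem_nseq andbF andbT; apply/(sortedP 0%N) => i.
by rewrite size_nseq /= !nth_column; lia.
Qed.

(** Only the strip of the first [a] rows can be added to the empty partition. *)
Lemma schur_column n a : (a <= n)%N -> schur n (nseq a 1%N) = mesym n rat a.
Proof.
move=> an; rewrite -[RHS]mul1r -(schur0 n) schur_mesym //.
have inc r : inrow [set i : 'I_n | (i < a)%N] r = (r < a)%N.
  have [lt|ge] := ltnP r n; first by rewrite (inrowE _ (Ordinal lt)) inE.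
  by rewrite inrow_out //; lia.
have v0 : vstrip [::] [set i : 'I_n | (i < a)%N].
  by apply/vstripP => // r; rewrite !inc !nth_nil; lia.
rewrite (big_pred1 [set i : 'I_n | (i < a)%N]) => [|I].
  congr schur; apply: part_ext; rewrite ?column_part ?add_strip_part // => i.
  by rewrite nth_add_strip // nth_nil inc nth_column.
apply/andP/eqP => [[/eqP c v]|->]; last by rewrite v0 card_initial.
rewrite -c; apply: initial_set => i j e; rewrite -!inrowE e.
by have /(_ i) := vstripP (lam := [::]) I isT v; rewrite !nth_nil !add0n; case: (inrow I i) => //; case: inrow.
Qed.

Lemma conj_partE lam c i : is_part lam -> (0 < c)%N ->
  (i < conj_part lam c)%N = (c <= nth 0 lam i)%N.
Proof.
rewrite /is_part /conj_part => /andP[so _] c0.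
elim: lam i so => [|x s IH] i so /=; first by rewrite nth_nil; lia.
have so' := path_sorted so; have [xc|xc] := leqP c x.
  by case: i => //= i; rewrite add1n ltnS IH.
have -> : count (fun x => (c <= x)%N) s = 0%N.
  apply/eqP; rewrite -leqn0 leqNgt IH // -ltnNge.
  by have := sorted_geq_nth so (leqnSn 0); rewrite /=; lia.
by have := sorted_geq_nth so (leq0n i); rewrite /=; lia.
Qed.

Lemma conj_part_le lam c n : (size lam <= n)%N -> (conj_part lam c <= n)%N.
Proof. exact: leq_trans (count_size _ _). Qed.

Lemma nth_two_columns mu i : is_part mu -> part mu 1 = 2%N ->
  nth 0%N mu i = ((i < conj_part mu 1) + (i < conj_part mu 2))%N.
Proof.
rewrite /part /= => pm m1; rewrite !conj_partE //.
by have := part_nth_le pm (leq0n i); rewrite m1; case: (nth _ _ _) => [|[|[]]].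
Qed.

(** Expand both products on columns.  A strip added to the column of length a
    either uses row a (numbered from 0), and then gives the same partition as a
    strip of one box less added to the column of length a + 1, or consists of the
    first b rows and gives mu. *)
Lemma schur_two_columns n mu : is_part mu -> part mu 1 = 2%N -> (size mu < n)%N ->
  schur n mu = mesym n rat (conj_part mu 1) * mesym n rat (conj_part mu 2)
    - mesym n rat (conj_part mu 1).+1 * mesym n rat (conj_part mu 2).-1.
Proof.
move=> pm m1 sm; set a := conj_part mu 1; set b := conj_part mu 2.
have an : (a < n)%N by apply: leq_ltn_trans sm; apply: conj_part_le.
have b0 : (0 < b)%N by rewrite conj_partE // -m1.
have ba : (b <= a)%N.
  rewrite leqNgt -/b /b conj_partE // -ltnNge.
  have : (a < conj_part mu 1)%N = false by rewrite ltnn.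
  by rewrite conj_partE //; lia.
pose o := Ordinal an.
rewrite -(schur_column (ltnW an)) -(schur_column an) !schur_mesym ?column_part ?size_nseq ?(ltnW an) //.
have rowo (I : {set 'I_n}) : o \in I -> addrows (nseq a 1%N) I = addrows (nseq a.+1 1%N) (I :\ o).
  move=> oI; apply/eq_in_map => r; rewrite mem_iota add0n => /andP[_ rn].
  rewrite !nth_column (inrowE I (Ordinal rn)) (inrowE _ (Ordinal rn)) !inE.
  have [e|ne] := eqVneq (Ordinal rn) o; first by rewrite e oI; move/(congr1 val): e => /= ->; rewrite ltnn ltnSn.
  have ra : r != a by apply: contra ne => /eqP ra; apply/eqP/val_inj.
  by rewrite andTb; congr (_ + _)%N; congr nat_of_bool; lia.
have vP c (I : {set 'I_n}) r : (c <= n)%N -> vstrip (nseq c 1%N) I -> r.+1 != c -> inrow I r.+1 -> inrow I r.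
  move=> cn v rc; have sc : (size (nseq c 1%N) <= n)%N by rewrite size_nseq.
  have := vstripP I sc v r; rewrite !nth_column => h h'; move: h; rewrite h'.
  by case: (inrow I r) => //; move: rc; lia.
pose I0 := [set i : 'I_n | (i < b)%N].
have inI0 r : inrow I0 r = (r < b)%N.
  have [lt|ge] := ltnP r n; first by rewrite (inrowE _ (Ordinal lt)) inE.
  by rewrite inrow_out //; lia.
have cI0 : #|I0| = b by apply: card_initial; lia.
have v0 : vstrip (nseq a 1%N) I0.
  by apply/vstripP => [|r]; rewrite ?size_nseq ?(ltnW an) // !nth_column !inI0; lia.
rewrite (bigID (fun I : {set 'I_n} => o \in I)) /= addrC (big_pred1 I0) => [|I].
  have -> : add_strip (nseq a 1%N) I0 = mu.
    apply: part_ext; rewrite ?add_strip_part // => i.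
    by rewrite nth_add_strip ?size_nseq ?(ltnW an) // nth_column inI0 nth_two_columns.
  rewrite -addrA -[LHS]addr0; congr (_ + _); apply/esym/eqP; rewrite subr_eq0; apply/eqP.
  rewrite (reindex_onto (fun I : {set 'I_n} => o |: I) (fun I : {set 'I_n} => I :\ o)) /=; last first.
    by move=> I /andP[_ oI]; rewrite setD1K.
  apply: eq_big => [I|I /andP[/andP[_ oI] /eqP e]].
    have [oI|oI] := boolP (o \in I).
      have -> : (o |: I) :\ o == I = false.
        by apply/eqP => /setP/(_ o); rewrite !inE eqxx oI.
      rewrite andbF; apply/esym/negP => /andP[/eqP cI v].
      suff /subset_leq_card : [set i : 'I_n | (i < a.+1)%N] \subset I by rewrite card_initial // cI; lia.
      apply/subsetP => j; rewrite inE ltnS => ja.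
      suff h m : (m <= a)%N -> inrow I (a - m).
        by rewrite -inrowE -(subKn ja); apply: h; rewrite leq_subr.
      elim: m => [|m IH] ma; first by rewrite subn0 -[a]/(nat_of_ord o) inrowE.
      apply: (vP a.+1) => //; first by lia.
      by rewrite (_ : (a - m.+1).+1 = a - m)%N ?IH //; lia.
    rewrite setU1K // eqxx andbT setU11 andbT cardsU1 oI add1n.
    by rewrite /vstrip rowo ?setU11 // setU1K //; congr (_ && _); rewrite -(prednK b0) eqSS.
  by rewrite /add_strip rowo // e.
apply/andP/eqP => [[/andP[/eqP cI v] oI]|->]; last by rewrite cI0 v0 inE eqxx /= -leqNgt.
rewrite /I0 -cI; apply: initial_set => i j e; rewrite -!inrowE e => h.
apply: (vP a) => //; first exact: ltnW.
by apply: contra oI => /eqP ia; rewrite -(inrowE I o) /= -ia.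
Qed.

(** * Fusion coefficients and chains of vertical strips *)

Lemma fusion_ideal0 n k : @fusion_ideal n k 0.
Proof. by exists [::]; rewrite ?big_nil. Qed.

Lemma fusion_idealD n k (p q : {mpoly rat[n]}) :
  fusion_ideal k p -> fusion_ideal k q -> fusion_ideal k (p + q).
Proof.
move=> [l al ->] [m am ->]; exists (l ++ m); first by rewrite all_cat al.
by rewrite big_cat.
Qed.

Lemma fusion_idealM n k (g p : {mpoly rat[n]}) : g \is mpoly.symmetric ->
  fusion_ideal k p -> fusion_ideal k (g * p).
Proof.
move=> sg [l /allP al ->]; exists [seq (g * x.1, x.2) | x <- l].
  apply/allP => _ /mapP[x xl ->] /=; case/andP: (al x xl) => sx ->.
  by rewrite andbT rpredM.
by rewrite big_map mulr_sumr; apply: eq_bigr => x _; rewrite mulrA.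
Qed.

Lemma fusion_idealB n k (p q : {mpoly rat[n]}) :
  fusion_ideal k p -> fusion_ideal k q -> fusion_ideal k (p - q).
Proof.
move=> hp hq; apply: fusion_idealD => //; rewrite -mulN1r; apply: fusion_idealM => //.
by rewrite rpredN rpred1.
Qed.

Lemma fusion_ideal_sum n k (T : finType) (P : pred T) (F : T -> {mpoly rat[n]}) :
  (forall i, P i -> fusion_ideal k (F i)) -> fusion_ideal k (\sum_(i | P i) F i).
Proof. by move=> h; apply: big_ind => //; [apply: fusion_ideal0 | move=> *; apply: fusion_idealD]. Qed.

Lemma fusion_ideal_generator n k lam : fusion_generator n k lam -> fusion_ideal k (schur n lam).
Proof.
move=> gl; exists [:: (1, lam)]; first by rewrite /= rpred1 gl.
by rewrite big_seq1 mul1r.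
Qed.

(** A vertical strip raises the difference of the first and the last part by at
    most one. *)
Lemma fusion_pieri n k lam r : restricted n k lam ->
  fusion_ideal k (schur n lam * mesym n rat r
   - \sum_(I : {set 'I_n} | [&& #|I| == r, vstrip lam I & restricted n k (add_strip lam I)])
       schur n (add_strip lam I)).
Proof.
move=> /and3P[pl sl wl]; rewrite schur_mesym // (bigID (fun I : {set 'I_n} => restricted n k (add_strip lam I))) /=.
rewrite addrAC (eq_bigl _ _ (fun I => esym (andbA _ _ _))) subrr add0r.
apply: fusion_ideal_sum => I /andP[/andP[_ v] nr]; apply: fusion_ideal_generator.
move: nr; rewrite /fusion_generator /restricted add_strip_part ?size_add_strip //=.
rewrite /part !nth_add_strip //=; move: wl; rewrite /part /=.
have := part_nth_le pl (leq0n n.-1).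
case: (inrow I 0); case: (inrow I n.-1); lia.
Qed.

(** The rows of the two strips of a chain of restricted partitions from [lam]. *)
Definition two_strips n k lam a b (p : {set 'I_n} * {set 'I_n}) : bool :=
  [&& #|p.1| == a, vstrip lam p.1, restricted n k (add_strip lam p.1),
      #|p.2| == b, vstrip (add_strip lam p.1) p.2
    & restricted n k (add_strip (add_strip lam p.1) p.2)].

Definition strip_pairs n k lam nu a b : {set {set 'I_n} * {set 'I_n}} :=
  [set p | two_strips k lam a b p && (add_strip (add_strip lam p.1) p.2 == nu)].

Lemma fusion_pieri2 n k lam a b : restricted n k lam ->
  fusion_ideal k (schur n lam * (mesym n rat a * mesym n rat b)
   - \sum_(p : {set 'I_n} * {set 'I_n} | two_strips k lam a b p) schur n (add_strip (add_strip lam p.1) p.2)).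
Proof.
move=> rl; set P1 := fun I : {set 'I_n} => [&& #|I| == a, vstrip lam I & restricted n k (add_strip lam I)].
set S1 := \sum_(I | P1 I) schur n (add_strip lam I).
have -> : forall S, schur n lam * (mesym n rat a * mesym n rat b) - S =
   mesym n rat b * (schur n lam * mesym n rat a - S1) + (S1 * mesym n rat b - S).
  by move=> S; ring.
apply: fusion_idealD; first by apply: fusion_idealM; [apply: mesym_sym | apply: fusion_pieri].
rewrite (eq_bigl (fun p : {set 'I_n} * {set 'I_n} => P1 p.1 && [&& #|p.2| == b, vstrip (add_strip lam p.1) p.2
    & restricted n k (add_strip (add_strip lam p.1) p.2)])); last first.
  by move=> p; rewrite /two_strips /P1 !andbA.
rewrite -(pair_big_dep P1 (fun I (J : {set 'I_n}) => [&& #|J| == b, vstrip (add_strip lam I) J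
    & restricted n k (add_strip (add_strip lam I) J)]) (fun I (J : {set 'I_n}) => schur n (add_strip (add_strip lam I) J))) /=.
rewrite /S1 mulr_suml -sumrB; apply: fusion_ideal_sum => I /and3P[_ _ rI].
exact: fusion_pieri.
Qed.

(** The coordinate is read off by a functional which ignores the ideal; hence it
    does not depend on the expansion. *)
Lemma expansion_coord n k (p : {mpoly rat[n]}) c nu : (0 < n)%N -> restricted n k nu ->
  fusion_expansion k p c -> c nu = residue_coef (n + k) (shifted_exponents n nu) (p * alternant n [::]).
Proof.
move=> n0 rn [s [us /allP rs cs [l /allP al e]]].
have -> : p = \sum_(i <- s) c i *: schur n i + \sum_(gl <- l) gl.1 * schur n gl.2.
  by rewrite -e addrC subrK.
rewrite mulrDl !mulr_suml raddfD !raddf_sum /=.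
rewrite [X in _ + X]big_seq [X in _ + X]big1 ?addr0 => [|gl gl_l]; last first.
  have /andP[_ g] := al _ gl_l; have /and3P[pg sg _] := g.
  by rewrite -mulrA schurE // residue_coef_generator.
rewrite big_seq (eq_bigr (fun i => c i * (i == nu)%:R)) => [|i is_]; last first.
  have ri := rs _ is_; have /and3P[pi si _] := ri.
  by rewrite -scalerAl residue_coefZ schurE // residue_coef_alternant.
rewrite -big_seq; have [ns|ns] := boolP (nu \in s).
  rewrite (bigD1_seq nu) //= eqxx mulr1 big1 ?addr0 // => i /negbTE ->; exact: mulr0.
rewrite cs // big_seq big1 // => i is_; case: eqP => [e'|]; rewrite ?mulr0 //.
by rewrite -e' is_ in ns.
Qed.

Lemma sum_fibres n (T : finType) (P : pred T) (g : T -> seq nat) (s : seq (seq nat)) :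
  uniq s -> (forall x, P x -> g x \in s) ->
  \sum_(x | P x) schur n (g x)
  = \sum_(nu <- s) #|[set x | P x && (g x == nu)]|%:R *: schur n nu.
Proof.
move=> us gs; rewrite (eq_bigr (fun x => \sum_(nu <- s | g x == nu) schur n nu)) => [|x Px]; last first.
  by rewrite -big_filter (eq_filter (a2 := pred1 (g x))) ?filter_pred1_uniq ?gs ?big_seq1 // => y; rewrite /= eq_sym.
rewrite (exchange_big_dep predT) //=; apply: eq_bigr => nu _.
rewrite sumr_const scaler_nat; congr (_ *+ _); rewrite -cardsE; apply: eq_card => x.
by rewrite !inE.
Qed.

Theorem fusion_coef_strips n k lam mu nu : (0 < n)%N ->
  restricted n k lam -> is_part mu -> restricted n k nu -> part mu 1 = 2%N -> (size mu < n)%N ->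
  fusion_coef n k lam mu nu =
    #|strip_pairs n k lam nu (conj_part mu 1) (conj_part mu 2)|%:R
    - #|strip_pairs n k lam nu (conj_part mu 1).+1 (conj_part mu 2).-1|%:R.
Proof.
move=> n0 rl pm rn m1 sm; set a := conj_part mu 1; set b := conj_part mu 2.
pose c nu := #|strip_pairs n k lam nu a b|%:R - #|strip_pairs n k lam nu a.+1 b.-1|%:R : rat.
suff h : fusion_expansion k (schur n lam * schur n mu) c.
  have h' := epsilon_spec (inhabits (fun=> 0)) _ (ex_intro _ c h).
  by rewrite /fusion_coef (expansion_coord n0 rn h') -(expansion_coord n0 rn h).
pose g (p : {set 'I_n} * {set 'I_n}) := add_strip (add_strip lam p.1) p.2.
pose P1 := @two_strips n k lam a b; pose P2 := @two_strips n k lam a.+1 b.-1.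
pose s := undup [seq g p | p in [pred p | P1 p || P2 p]].
have us : uniq s by apply: undup_uniq.
have s1 p : P1 p -> g p \in s by move=> h; rewrite mem_undup image_f // unfold_in /= h.
have s2 p : P2 p -> g p \in s by move=> h; rewrite mem_undup image_f // unfold_in /= h orbT.
exists s; split=> //.
- apply/allP => x; rewrite mem_undup => /imageP[p] /orP[] /and3P[_ _ /and4P[_ _ _ h]] -> //.
- move=> x xs; rewrite /c; suff -> : strip_pairs n k lam x a b = set0.
    suff -> : strip_pairs n k lam x a.+1 b.-1 = set0 by rewrite cards0 subrr.
    by apply/setP => p; rewrite !inE; apply/negP => /andP[/s2 h /eqP e]; rewrite -e h in xs.
  by apply/setP => p; rewrite !inE; apply/negP => /andP[/s1 h /eqP e]; rewrite -e h in xs.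
rewrite (schur_two_columns pm m1 sm) mulrBr -/a -/b.
have -> : \sum_(x <- s) c x *: schur n x = \sum_(p : {set 'I_n} * {set 'I_n} | P1 p) schur n (g p) - \sum_(p : {set 'I_n} * {set 'I_n} | P2 p) schur n (g p).
  rewrite (sum_fibres n us s1) (sum_fibres n us s2) -sumrB; apply: eq_bigr => x _.
  by rewrite /c scalerBl.
have hv := fusion_pieri2 a b rl; have hu := fusion_pieri2 a.+1 b.-1 rl.
have -> : forall x y u v : {mpoly rat[n]}, x - y - (u - v) = (x - u) - (y - v) by move=> *; ring.
exact: fusion_idealB.
Qed.

(** * Counting lattice words *)

Lemma card_bij (T1 T2 : finType) (A : {set T1}) (B : {set T2}) (e : T1 -> T2) (f : T2 -> T1) :
  (forall x, x \in A -> e x \in B /\ f (e x) = x) ->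
  (forall y, y \in B -> f y \in A /\ e (f y) = y) -> #|A| = #|B|.
Proof.
move=> he hf; have inj : {in A &, injective e}.
  by apply: (can_in_inj (g := f)) => x /he[].
rewrite -(card_in_imset inj); apply: eq_card => y; apply/imsetP/idP => [[x /he[h _] -> //]|].
by move=> /hf[h e']; exists (f y).
Qed.

Lemma first_min (F : nat -> int) m : exists2 r, (r <= m)%N &
  forall r', (r' <= m)%N -> F r <= F r' /\ ((r' < r)%N -> F r < F r').
Proof.
elim: m => [|m [r rm h]]; first by exists 0%N => // r'; case: r'.
have [lt|ge] := ltP (F m.+1) (F r).
  exists m.+1 => // r'; rewrite leq_eqVlt => /orP[/eqP ->|]; first by rewrite ltnn lexx.
  by rewrite ltnS => /h [? _]; split; lia.
exists r; first exact: leqW.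
by move=> r'; rewrite leq_eqVlt => /orP[/eqP ->|/h //]; split=> //; lia.
Qed.

Lemma last_min (F : nat -> int) m : exists2 r, (r <= m)%N &
  forall r', (r' <= m)%N -> F r <= F r' /\ ((r < r')%N -> F r < F r').
Proof.
elim: m => [|m [r rm h]]; first by exists 0%N => // r'; case: r'.
have [le|lt] := leP (F m.+1) (F r).
  exists m.+1 => // r'; rewrite leq_eqVlt => /orP[/eqP ->|]; first by rewrite ltnn lexx.
  by rewrite ltnS => r'm; have [? _] := h _ r'm; split; lia.
exists r; first exact: leqW.
by move=> r'; rewrite leq_eqVlt => /orP[/eqP ->|/h //]; split=> //; lia.
Qed.

(** The balance of the parentheses of the rows from the top down to row [r]. *)
Definition height n (free J : {set 'I_n}) (r : nat) : int :=
  \sum_(i in free | (r <= i)%N) (if i \in J then 1 else -1).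

(** [glue i j] stands for: row [j] is just above row [i] in the same column of free
    boxes.  The first strip fills such a column from below. *)
Definition admissible n (free : {set 'I_n}) (glue : rel 'I_n) (J : {set 'I_n}) : bool :=
  (J \subset free) && [forall i, forall j, glue i j ==> (j \in J) ==> (i \in J)].

Definition lattice n (free J : {set 'I_n}) : bool := [forall i : 'I_n, 0 <= height free J i].

Lemma admissibleP n (free : {set 'I_n}) (glue : rel 'I_n) (J : {set 'I_n}) :
  reflect (J \subset free /\ forall i j, glue i j -> j \in J -> i \in J) (admissible free glue J).
Proof.
apply: (iffP andP) => [[s /forallP h]|[s h]]; split=> //.
  by move=> i j g jJ; have /forallP/(_ j) := h i; rewrite g jJ.
by apply/forallP => i; apply/forallP => j; apply/implyP => g; apply/implyP; apply: h.
Qed.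

Lemma height_out n (free J : {set 'I_n}) r : (n <= r)%N -> height free J r = 0.
Proof. by move=> nr; rewrite /height big_pred0 // => i; have := ltn_ord i; lia. Qed.

Lemma heightS n (free J : {set 'I_n}) (i : 'I_n) :
  height free J i = (if i \in free then if i \in J then 1 else -1 else 0) + height free J i.+1.
Proof.
rewrite /height; case: ifP => iF; last first.
  rewrite add0r; apply: eq_bigl => j; case jF: (j \in free) => //=.
  rewrite leq_eqVlt; case: eqP => //= e; have e' : i = j by apply: val_inj.
  by rewrite -e' iF in jF.
rewrite (bigD1 i) /= ?iF ?leqnn //; congr (_ + _); apply: eq_bigl => j.
by rewrite -andbA; congr (_ && _); rewrite ltn_neqAle andbC eq_sym.
Qed.

Lemma height_setU1 n (free J : {set 'I_n}) x r : x \in free -> x \notin J ->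
  height free (x |: J) r = height free J r + (if (r <= x)%N then 2 else 0).
Proof.
move=> xF xJ; rewrite /height; case: ifP => rx; last first.
  rewrite addr0; apply: eq_bigr => i /andP[_ ri]; rewrite !inE.
  by case: eqP => // e; rewrite -e ri in rx.
rewrite (bigD1 x) /= ?xF // [in RHS](bigD1 x) /= ?xF // !inE eqxx (negbTE xJ) /=.
rewrite (eq_bigr (fun i => if i \in J then 1 else -1)) => [|i /andP[_ /negbTE ne]].
  by move: (bigop.body _ _ _) => S; lia.
by rewrite !inE ne.
Qed.

Lemma height_total n (free J : {set 'I_n}) : J \subset free ->
  height free J 0 = (2 * #|J|)%:Z - #|free|%:Z.
Proof.
move=> sub; rewrite /height (bigID (mem J)) /=.
rewrite (eq_big (fun i => i \in J) (fun=> 1)) => [|i|i /andP[_ ->]] //; last first.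
  by case iJ : (i \in J); rewrite ?andbF // (subsetP sub _ iJ).
rewrite [X in _ + X](eq_big (fun i => i \in free :\: J) (fun=> -1)) => [|i|i /andP[_ /negbTE ->]] //; last first.
  by rewrite inE andbT andbC.
rewrite !sumr_const; have := cardsID J free; rewrite (setIidPr sub) => <-.
by rewrite mulNrn !natz; move: #|J| #|_ :\: _| => a b; rewrite mul2n -addnn !PoszD; ring.
Qed.

Section Crystal.
Variables (n : nat) (free : {set 'I_n}) (glue : rel 'I_n).
Hypothesis glueP : forall i j, glue i j -> [/\ j = i.+1 :> nat, i \in free & j \in free].
Local Notation h := (height free).
Local Notation adm := (admissible free glue).

(** Row [x] is the last unmatched right parenthesis: after reading it, the height
    attains its minimum for the first time. *)
Let up (J : {set 'I_n}) (x : 'I_n) : bool := [&& x \in free, x \notin J &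
  [forall r : 'I_n.+1, (h J x <= h J r) && ((x < r)%N ==> (h J x < h J r))]].
(** Row [x] is the first unmatched left parenthesis: just before reading it, the
    height attains its minimum for the last time. *)
Let dn (J : {set 'I_n}) (x : 'I_n) : bool := [&& x \in free, x \in J &
  [forall r : 'I_n.+1, (h J x.+1 <= h J r) && ((r <= x)%N ==> (h J x.+1 < h J r))]].

Let upP J x : up J x -> forall r, (r <= n)%N -> h J x <= h J r /\ ((x < r)%N -> h J x < h J r).
Proof.
case/and3P=> _ _ /forallP hr r rn; have rn' : (r < n.+1)%N by [].
by have /andP[? /implyP ?] := hr (Ordinal rn').
Qed.

Let dnP J x : dn J x -> forall r, (r <= n)%N -> h J x.+1 <= h J r /\ ((r <= x)%N -> h J x.+1 < h J r).
Proof.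
case/and3P=> _ _ /forallP hr r rn; have rn' : (r < n.+1)%N by [].
by have /andP[? /implyP ?] := hr (Ordinal rn').
Qed.

Let up_uniq J x y : up J x -> up J y -> x = y.
Proof.
move=> ux uy; have [a b] := upP ux (ltnW (ltn_ord y)); have [c d] := upP uy (ltnW (ltn_ord x)).
apply: val_inj => /=; lia.
Qed.

Let dn_uniq J x y : dn J x -> dn J y -> x = y.
Proof.
move=> ux uy; have [a b] := dnP ux (ltn_ord y); have [c d] := dnP uy (ltn_ord x).
apply: val_inj => /=; lia.
Qed.

Let up_dn J x : up J x -> dn (x |: J) x.
Proof.
move=> ux; have /and3P[xF xJ _] := ux; apply/and3P; split; rewrite ?setU11 //.
apply/forallP => r; have rn : (r <= n)%N by have := ltn_ord r; lia.
have [a b] := upP ux rn; have := heightS free J x; rewrite xF (negbTE xJ) => e.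
by rewrite !height_setU1 // ltnn; case: leqP => rx /=; [lia | have := b rx; lia].
Qed.

Let dn_up J x : dn J x -> up (J :\ x) x.
Proof.
move=> ux; have /and3P[xF xJ _] := ux; apply/and3P; split; rewrite ?setD11 //.
apply/forallP => r; have rn : (r <= n)%N by have := ltn_ord r; lia.
have [a b] := dnP ux rn; have := heightS free J x; rewrite xF xJ => e.
have hD r' : h J r' = h (J :\ x) r' + (if (r' <= x)%N then 2 else 0).
  by rewrite -height_setU1 ?setD11 // setD1K.
move: a b e; rewrite !hD ltnn leqnn; case: leqP => rx /=; lia.
Qed.

Let up_ex J : adm J -> ~~ lattice free J -> exists x, up J x.
Proof.
case/admissibleP=> sub _ /forallPn[i hi]; have [r rn hr] := last_min (h J) n.
have neg : h J r < 0 by have [] := hr i (ltnW (ltn_ord i)); lia.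
have lt : (r < n)%N by rewrite ltnNge; apply/negP => /(height_out free J) e; lia.
exists (Ordinal lt); have [_ /(_ (ltnSn r))] := hr r.+1 lt.
have /= := heightS free J (Ordinal lt); case: ifP => xF e lt'; last by lia.
case: ifP e => xJ e; first by lia.
rewrite /up xF xJ /=; apply/forallP => r'; have rn' : (r' <= n)%N by have := ltn_ord r'; lia.
by have [a b] := hr _ rn'; rewrite a /=; apply/implyP.
Qed.

Let dn_ex J : adm J -> (#|free| < 2 * #|J|)%N -> exists x, dn J x.
Proof.
case/admissibleP=> sub _ big; have [r rn hr] := first_min (h J) n.
have t := height_total sub; have z := height_out free J (leqnn n).
have [z1 _] := hr n (leqnn n); have [t1 _] := hr 0%N (leq0n n).
case: r rn hr z1 t1 => [|r] rn hr z1 t1; first by lia.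
exists (Ordinal rn); have [_ /(_ (ltnSn r))] := hr r (ltnW rn).
have /= := heightS free J (Ordinal rn); case: ifP => xF e lt'; last by lia.
case: ifP e => xJ e; last by lia.
rewrite /dn xF xJ /=; apply/forallP => r'; have rn' : (r' <= n)%N by have := ltn_ord r'; lia.
by have [a b] := hr _ rn'; rewrite a /=; apply/implyP.
Qed.

Let up_adm J x : adm J -> up J x -> adm (x |: J).
Proof.
case/admissibleP=> sub hJ ux; have /and3P[xF xJ _] := ux; apply/admissibleP; split.
  by apply/subsetP => y; rewrite !inE => /orP[/eqP -> //|/(subsetP sub)].
move=> i j g; rewrite !inE => /orP[/eqP jx|/(hJ _ _ g) ->]; last exact: orbT.
have [ji iF _] := glueP g; apply: contraT; rewrite negb_or => /andP[ix iJ].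
have [a _] := upP ux (ltnW (ltn_ord i)).
by have := heightS free J i; rewrite iF (negbTE iJ) -ji jx; lia.
Qed.

Let dn_adm J x : adm J -> dn J x -> adm (J :\ x).
Proof.
case/admissibleP=> sub hJ ux; have /and3P[xF xJ _] := ux; apply/admissibleP; split.
  by apply: subset_trans sub; apply: subD1set.
move=> i j g; rewrite !inE => /andP[jx jJ]; rewrite (hJ _ _ g jJ) andbT.
have [ji iF jF] := glueP g; apply/eqP => ix.
have [a _] := dnP ux (ltn_ord j).
by have := heightS free J j; rewrite jF jJ; move: a; rewrite ji ix; lia.
Qed.

(** Opening the last unmatched right parenthesis, which is where the minimum of
    the heights is first attained, is inverse to closing the first unmatched left
    parenthesis, which follows the last minimum.  Admissibility is preserved, since
    the neighbour in the same column has the parenthesis that the minimum forces. *)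
Lemma lattice_count s : (#|free| <= 2 * s)%N ->
  #|[set J | adm J & #|J| == s]|
  = (#|[set J | adm J & #|J| == s.+1]| + #|[set J | adm J & (#|J| == s) && lattice free J]|)%N.
Proof.
move=> hs; rewrite -(cardsID [set J | lattice free J]) addnC; congr (_ + _)%N; last first.
  by apply: eq_card => J; rewrite !inE andbA.
pose e J := if [pick x | up J x] is Some x then x |: J else J.
pose f J := if [pick x | dn J x] is Some x then J :\ x else J.
have eE J x : up J x -> e J = x |: J.
  by move=> ux; rewrite /e; case: pickP => [y uy|/(_ x)]; [rewrite (up_uniq ux uy) | rewrite ux].
have fE J x : dn J x -> f J = J :\ x.
  by move=> ux; rewrite /f; case: pickP => [y uy|/(_ x)]; [rewrite (dn_uniq ux uy) | rewrite ux].
apply: (card_bij (e := e) (f := f)) => J; rewrite !inE.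
  case/and3P=> nl aJ /eqP cJ; have [x ux] := up_ex aJ nl; have /and3P[_ xJ _] := ux.
  rewrite (eE _ _ ux) (fE _ x (up_dn ux)) setU1K //; split=> //.
  by rewrite up_adm // cardsU1 xJ cJ add1n eqxx.
case/andP=> aJ /eqP cJ; have [x ux] := dn_ex aJ ltac:(lia); have /and3P[_ xJ _] := ux.
rewrite (fE _ _ ux) (eE _ x (dn_up ux)) setD1K //; split=> //.
rewrite dn_adm // (cardsD1 x J) xJ in cJ *.
move: cJ; rewrite add1n => -[->]; rewrite eqxx !andbT; apply/negP => /forallP/(_ x).
have [a _] := dnP ux (leqnn n); have z := height_out free J (leqnn n).
have /and3P[xF _ _] := ux; have := heightS free (J :\ x) x; rewrite xF setD11.
have := height_setU1 x.+1 xF (negbT (setD11 x J)); rewrite (setD1K xJ) ltnn addr0 => e1 -> le.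
by rewrite z e1 in a; move: (height _ _ _) a le => y; lia.
Qed.

End Crystal.

(** * Columns that wrap around the cylinder *)

Definition free_rows n (lam nu : seq nat) : {set 'I_n} :=
  [set i : 'I_n | nth 0%N nu i == (nth 0%N lam i).+1].
Definition double_rows n (lam nu : seq nat) : {set 'I_n} :=
  [set i : 'I_n | nth 0%N nu i == (nth 0%N lam i).+2].
Definition same_column n (lam nu : seq nat) : rel 'I_n := fun i j =>
  [&& j == i.+1 :> nat, i \in free_rows n lam nu, j \in free_rows n lam nu
    & nth 0%N lam i == nth 0%N lam j].
(** If row 0 is free, these are the rows of its column of free boxes. *)
Definition last_column_rows n (lam nu : seq nat) : {set 'I_n} :=
  [set i in free_rows n lam nu | nth 0%N lam i == nth 0%N lam 0%N].

(** On the cylinder, row 0 lies above row [n.-1] in the same column of free boxes. *)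
Definition wraps n k (lam nu : seq nat) : bool :=
  [&& nth 0%N lam 0%N == (nth 0%N lam n.-1 + k)%N, nth 0%N nu 0%N == (nth 0%N lam 0%N).+1
    & nth 0%N nu n.-1 == (nth 0%N lam n.-1).+1].

(** The row form of D_2: the word has a right parenthesis in the column of row 0,
    and its height is positive before this column begins. *)
Definition excluded n k (lam nu : seq nat) (J : {set 'I_n}) : bool :=
  let B := last_column_rows n lam nu in
  [&& wraps n k lam nu, ~~ (B \subset J)
    & [forall r : 'I_n, (r \notin B) ==> (1 <= height (free_rows n lam nu) J r)]].

(** If the last column wraps, this means that the intermediate partition is not
    restricted. *)
Definition wrong_wrap n (J : {set 'I_n}) := inrow J 0 && ~~ inrow J n.-1.

Section Wrap.
Variables (n k : nat) (lam nu : seq nat).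
Hypotheses (n_gt0 : (0 < n)%N) (k_gt0 : (0 < k)%N).
Hypotheses (lam_part : is_part lam) (nu_part : is_part nu).
Hypothesis wr : wraps n k lam nu.

Local Notation F := (free_rows n lam nu).
Local Notation glue := (@same_column n lam nu).
Local Notation B := (last_column_rows n lam nu).
Let z : 'I_n := Ordinal n_gt0.
Let ltl : (n.-1 < n)%N. Proof. by rewrite prednK. Qed.
Let l : 'I_n := Ordinal ltl.

Lemma same_column_free i j : glue i j -> [/\ j = i.+1 :> nat, i \in F & j \in F].
Proof. by case/and4P=> /eqP. Qed.

Let zF : z \in F. Proof. by case/and3P: wr => _ h _; rewrite inE. Qed.
Let lF : l \in F. Proof. by case/and3P: wr => _ _ h; rewrite inE. Qed.
Let zB : z \in B. Proof. by rewrite inE zF /=. Qed.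
Let lB : l \notin B.
Proof. by rewrite inE lF /=; case/and3P: wr => /eqP; lia. Qed.
Let BF i : i \in B -> i \in F. Proof. by rewrite inE => /andP[]. Qed.
Let glueB i j : glue i j -> (i \in B) = (j \in B).
Proof. by case/and4P=> _ iF jF /eqP e; rewrite !inE in iF jF *; rewrite iF jF e. Qed.

Let B_down (i j : 'I_n) : j = i.+1 :> nat -> j \in B -> glue i j.
Proof.
move=> ji; rewrite /same_column !inE ji eqxx => /andP[/eqP jF /eqP jB]; rewrite jF jB eqxx /=.
have := part_nth_le lam_part (leqnSn i); have := part_nth_le nu_part (leqnSn i).
have := part_nth_le lam_part (leq0n i); have := part_nth_le nu_part (leq0n i).
have /eqP : nth 0%N nu 0%N == (nth 0%N lam 0%N).+1 by case/and3P: wr.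
by lia.
Qed.

Let m := #|B|.
Let BE (i : 'I_n) : (i \in B) = (i < m)%N.
Proof.
have -> : B = [set i : 'I_n | (i < m)%N]; last by rewrite inE.
by apply: initial_set => a b ba bB; rewrite (glueB (B_down ba bB)).
Qed.

Let m_gt0 : (0 < m)%N. Proof. by rewrite -(BE z). Qed.
Let ltt : (m.-1 < n)%N.
Proof. have : (m <= n)%N by rewrite -[n in leqRHS]card_ord max_card. by move: m_gt0; lia. Qed.
Let t : 'I_n := Ordinal ltt.
Let tB : t \in B. Proof. by rewrite BE /= prednK. Qed.
Let tl : t != l. Proof. by apply: contraNneq lB => <-. Qed.

(** A wrong wrap fixes the letter of row [n.-1] and forces one in the last column;
    its other letters are free, as if the top row of that column were missing. *)
Let F' := F :\ t :\ l.
Let glue' : rel 'I_n := fun i j => [&& glue i j, i \in F' & j \in F'].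
Local Notation adm := (admissible F glue).
Local Notation adm' := (admissible F' glue').

Let F'E i : (i \in F') = [&& i != l, i != t & i \in F].
Proof. by rewrite !inE. Qed.

Let cardF' : #|F| = #|F'|.+2.
Proof.
by rewrite (cardsD1 t) (BF tB) (cardsD1 l (F :\ t)) !inE eq_sym tl /= -[_ == _]/(_) ; move: lF; rewrite inE => ->.
Qed.

Let sub_adm' J : adm' J -> J \subset F'. Proof. by case/andP. Qed.

Let adm'_down J i j : adm' J -> glue i j -> j \in J -> i \in J.
Proof.
case/admissibleP=> sub h g jJ; have jF' := subsetP sub j jJ; apply: (h i j) => //.
rewrite /glue' g jF' andbT /= F'E; case/and4P: (g) => /eqP ji iF jF _; rewrite iF andbT.
apply/andP; split; apply/eqP => e.
  by have := ltn_ord j; rewrite ji e /= prednK // ltnn.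
move: jF'; rewrite F'E => /and3P[_ _ _].
have : j \in B by rewrite -(glueB g) e.
by rewrite BE ji e /= prednK // ltnn.
Qed.

Let capB (J : {set 'I_n}) : (forall i j, glue i j -> j \in J -> i \in J) ->
  forall i : 'I_n, (i \in J :&: B) = (i < #|J :&: B|)%N.
Proof.
move=> h i; have -> : J :&: B = [set i : 'I_n | (i < #|J :&: B|)%N]; last first.
  by rewrite inE card_initial // -[n in leqRHS]card_ord max_card.
apply: initial_set => a b ba; rewrite !in_setI => /andP[bJ bB].
have g := B_down ba bB; by rewrite (h _ _ g bJ) (glueB g).
Qed.

Let shorten (J : {set 'I_n}) := [set i in J | i != #|J :&: B|.-1 :> nat].
Let lengthen (J : {set 'I_n}) := [set i : 'I_n | (i \in J) || (i == #|J :&: B| :> nat)].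

Let wrong_wrapE (J : {set 'I_n}) : wrong_wrap J = (z \in J) && (l \notin J).
Proof. by rewrite /wrong_wrap -(inrowE J z) -(inrowE J l). Qed.

(** In the last column, [J] fills an initial segment, which contains row 0.
    Shortening it by one makes it an arbitrary initial segment of the column
    without its top row. *)
Lemma wrong_wrap_count s :
  #|[set J | adm J & (#|J| == s.+1) && wrong_wrap J]| = #|[set J | adm' J & #|J| == s]|.
Proof.
apply: (card_bij (e := shorten) (f := lengthen)) => J; rewrite !inE wrong_wrapE.
  case/and3P=> aJ /eqP cJ /andP[zJ lJ]; have /admissibleP[sub hJ] := aJ.
  have JB := capB hJ; set c := #|J :&: B| in JB *.
  have c0 : (0 < c)%N by rewrite -(JB z) inE zJ.
  have cm : (c <= m)%N by apply: subset_leq_card; apply: subsetIr.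
  have ltc : (c.-1 < n)%N by move: ltt c0 cm; clear; move: (m) => m'; lia.
  pose x := Ordinal ltc; have xJ : x \in J.
    by have := JB x; rewrite in_setI /= prednK // leqnn => /andP[].
  have eJ : shorten J = J :\ x by apply/setP => i; rewrite !inE andbC -val_eqE.
  have xB : x \in B by rewrite BE /= prednK.
  have cE : #|(J :\ x) :&: B| = c.-1.
    have -> : (J :\ x) :&: B = (J :&: B) :\ x.
      by apply/setP => i; rewrite !inE; case: (i == x).
    by rewrite /c [in RHS](cardsD1 x) inE xJ xB.
  split; last first.
    rewrite eJ /lengthen cE; apply/setP => i; rewrite !inE -val_eqE /=; case: eqP => //= ix; last by rewrite orbF.
    by rewrite (_ : i = x) ?xJ //; apply: val_inj.
  rewrite eJ; apply/andP; split; last by move: cJ; rewrite (cardsD1 x) xJ add1n => -[->].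
  apply/admissibleP; split.
    apply/subsetP => i; rewrite in_setD1 => /andP[ix iJ]; rewrite F'E (subsetP sub) // andbT.
    apply/andP; split; first by apply: contraNneq lJ => <-.
    apply: contraNneq ix => it; have : i \in J :&: B by rewrite inE iJ it.
    by rewrite JB it /= -val_eqE /=; move: c0 cm; move: (m) (c) => m' c'; clear; lia.
  move=> i j /and3P[g _ _]; rewrite !in_setD1 => /andP[_ jJ]; rewrite (hJ _ _ g jJ) andbT.
  apply/eqP => ix; have : j \in J :&: B by rewrite inE jJ -(glueB g) ix.
  by rewrite JB; case/and4P: g => /eqP -> _ _ _; rewrite ix /= prednK // ltnn.
case/andP=> aJ /eqP cJ; have hJ i j := @adm'_down J i j aJ.
have sub := subsetP (sub_adm' aJ); have JB := capB hJ; set c := #|J :&: B| in JB *.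
have tJ : t \notin J by apply/negP => /sub; rewrite F'E eqxx andbF.
have lJ : l \notin J by apply/negP => /sub; rewrite F'E eqxx.
have cm : (c < m)%N.
  rewrite ltnNge; apply: contra tJ => mc; have : t \in J :&: B by rewrite JB /= prednK.
  by rewrite inE => /andP[].
have ltc : (c < n)%N by apply: leq_trans cm _; rewrite -(prednK m_gt0).
pose x := Ordinal ltc; have xB : x \in B by rewrite BE.
have xJ : x \notin J by have := JB x; rewrite inE xB andbT /= ltnn => ->.
have fJ : lengthen J = x |: J by apply/setP => i; rewrite !inE orbC -val_eqE.
have cE : #|(x |: J) :&: B| = c.+1.
  have -> : (x |: J) :&: B = x |: (J :&: B).
    by apply/setP => i; rewrite !inE; case: eqP => // ->; move: xB; rewrite !inE => ->.
  by rewrite cardsU1 inE (negbTE xJ).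
rewrite fJ /shorten cE /=; split; last first.
  apply/setP => i; rewrite !inE -val_eqE /=; case: eqP => /= ix; last by rewrite andbT.
  by apply/esym/negbTE; rewrite (_ : i = x) //; apply: val_inj.
apply/and4P; split.
- apply/admissibleP; split.
    apply/subsetP => i; rewrite in_setU1 => /orP[/eqP -> |/sub]; first exact: BF.
    by rewrite F'E => /and3P[].
  move=> i j g; rewrite !in_setU1 => /orP[/eqP jx|jJ]; last by rewrite (hJ _ _ g jJ) orbT.
  have : i \in J :&: B by rewrite JB; case/and4P: g => /eqP ji _ _ _; move: ji; rewrite jx /= => ->.
  by rewrite in_setI => /andP[->]; rewrite orbT.
- by rewrite cardsU1 xJ cJ.
- rewrite in_setU1 -val_eqE /=; have [->//|c0] := posnP c.
  have zJB : z \in J :&: B by rewrite JB.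
  by move: zJB; rewrite in_setI => /andP[->]; rewrite orbT.
rewrite in_setU1 negb_or lJ andbT; apply: contraNneq lB => ->; exact: xB.
Qed.

Let heightE (J : {set 'I_n}) (r : 'I_n) : l \in J -> t \notin J ->
  height F J r = height F' (J :\ l) r + (if r \in B then 0 else 1).
Proof.
move=> lJ tJ; rewrite /height (bigID (mem F')) /=.
rewrite [X in _ + X](eq_bigl (fun i => (i \in [set t; l]) && (r <= i)%N)); last first.
  move=> i; rewrite F'E in_set2; have [->|it] := eqVneq i t.
    by rewrite (BF tB) andbF andbT.
  have [->|il] := eqVneq i l; first by rewrite lF /= andbT.
  by case: (i \in F); rewrite /= ?andbF.
congr (_ + _).
  apply: eq_big => [i|i /andP[_ iF']].
    by rewrite F'E; case: (i \in F); rewrite ?andbF ?andbT // andbC.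
  by rewrite in_setD1; move: iF'; rewrite F'E => /and3P[->].
rewrite big_mkcondr big_setU1 ?in_set1 //= big_set1 lJ (negbTE tJ) BE.
have -> : (r <= n.-1)%N by rewrite -ltnS prednK.
have -> : (r <= m.-1)%N = (r < m)%N by rewrite -ltnS prednK.
by case: ifP.
Qed.

(** Deleting row [n.-1], a left parenthesis, and the top row of the last column, a
    right parenthesis, lowers the heights by one between them, and leaves them
    unchanged after both. *)
Lemma excluded_count s :
  #|[set J | adm J & (#|J| == s.+1) && (lattice F J && excluded k lam nu J)]|
  = #|[set J | adm' J & (#|J| == s) && lattice F' J]|.
Proof.
apply: (card_bij (e := fun J : {set 'I_n} => J :\ l) (f := fun J : {set 'I_n} => l |: J)) => J; rewrite !inE.
  case/and4P=> aJ /eqP cJ /forallP la /and3P[_ nB /forallP ex]; have /admissibleP[sub hJ] := aJ.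
  have JB := capB hJ.
  have lJ : l \in J.
    have := ex l; rewrite lB implyTb (heightS F J l) lF height_out; last by rewrite /= prednK.
    by case: (l \in J).
  have tJ : t \notin J.
    apply: contra nB => tJ; apply/subsetP => i; rewrite BE => im.
    have : i \in J :&: B; last by rewrite inE => /andP[].
    have : t \in J :&: B by rewrite inE tJ tB.
    by rewrite !JB /= prednK // => /(leq_trans im).
  rewrite setD1K //; split=> //; apply/and3P; split.
  - apply/admissibleP; split.
      apply/subsetP => i; rewrite in_setD1 => /andP[il iJ]; rewrite F'E il (subsetP sub) // andbT.
      by apply: contraNneq tJ => <-.
    move=> i j /and3P[g iF' _]; rewrite !in_setD1 => /andP[_ jJ]; rewrite (hJ _ _ g jJ) andbT.
    by move: iF'; rewrite F'E => /and3P[].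
  - by move: cJ; rewrite (cardsD1 l) lJ add1n => -[->].
  apply/forallP => r; have := ex r; have := la r; rewrite heightE //.
  by case: (r \in B) => /=; move: (height _ _ _) => y; clear; lia.
case/and3P=> aJ /eqP cJ /forallP la; have hJ i j := @adm'_down J i j aJ.
have sub := subsetP (sub_adm' aJ).
have tJ : t \notin J by apply/negP => /sub; rewrite F'E eqxx andbF.
have lJ : l \notin J by apply/negP => /sub; rewrite F'E eqxx.
have hE (r : 'I_n) : height F (l |: J) r = height F' J r + (if r \in B then 0 else 1).
  by rewrite heightE ?setU11 ?setU1K // in_setU1 negb_or tJ andbT.
rewrite setU1K //; split=> //; apply/and4P; split.
- apply/admissibleP; split.
    apply/subsetP => i; rewrite in_setU1 => /orP[/eqP -> //|/sub]; by rewrite F'E => /and3P[].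
  move=> i j g; rewrite !in_setU1 => /orP[/eqP jl|jJ]; last by rewrite (hJ _ _ g jJ) orbT.
  have /and4P[/eqP ji iF jF _] := g.
  have iF' : i \in F'.
    rewrite F'E iF andbT; apply/andP; split; apply/eqP => e'.
      by move: ji; rewrite jl e' /= => /n_Sn.
    by have := lB; rewrite -jl -(glueB g) e' tB.
  have e0 : height F' J l = 0.
    by rewrite (heightS F' J l) F'E eqxx /= add0r height_out //= prednK.
  have := la i; rewrite heightS iF' -ji jl e0.
  by case: (i \in J); rewrite ?orbT.
- by rewrite cardsU1 lJ cJ.
- by apply/forallP => r; have := la r; rewrite hE; case: ifP => _; move: (height _ _ _) => y; clear; lia.
apply/and3P; split=> //.
  by apply: contra tJ => /subsetP/(_ t tB); rewrite in_setU1 (negbTE tl).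
by apply/forallP => r; apply/implyP => /negbTE rB; have := la r; rewrite hE rB; move: (height _ _ _) => y; clear; lia.
Qed.

Lemma wrap_difference s : (#|F| <= 2 * s.+1)%N ->
  #|[set J | adm J & (#|J| == s.+1) && wrong_wrap J]|
  = (#|[set J | adm J & (#|J| == s.+2) && wrong_wrap J]|
     + #|[set J | adm J & (#|J| == s.+1) && (lattice F J && excluded k lam nu J)]|)%N.
Proof.
move=> Fs; rewrite !wrong_wrap_count excluded_count; apply: lattice_count => [i j|].
  by case/and3P=> /and4P[/eqP ? _ _ _] ? ?.
by move: Fs; rewrite cardF' mulnS !add2n !ltnS.
Qed.

End Wrap.

(** * Chains of vertical strips as words *)

Lemma strip_pairsP n k lam nu a b (p : {set 'I_n} * {set 'I_n}) :
  restricted n k lam -> p \in strip_pairs n k lam nu a b ->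
  [/\ #|p.1| = a /\ #|p.2| = b, vstrip lam p.1, restricted n k (add_strip lam p.1),
      vstrip (add_strip lam p.1) p.2
    & forall r, nth 0%N nu r = (nth 0 lam r + inrow p.1 r + inrow p.2 r)%N].
Proof.
case/and3P=> _ sl _; rewrite inE => /andP[/and3P[/eqP c1 v1 /and4P[r1 /eqP c2 v2 _]] /eqP e]; split=> // r.
by rewrite -e nth_add_strip ?size_add_strip // nth_add_strip.
Qed.

Lemma strip_rows n k lam nu a b (p : {set 'I_n} * {set 'I_n}) (F := free_rows n lam nu) (D := double_rows n lam nu) :
  restricted n k lam -> p \in strip_pairs n k lam nu a b ->
  [/\ forall i : 'I_n, (nth 0 lam i <= nth 0 nu i <= (nth 0 lam i).+2)%N,
      (#|F| + 2 * #|D| = a + b)%N,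
      p.1 = (p.1 :&: F) :|: D & p.2 = (F :\: p.1) :|: D].
Proof.
move=> rl /(strip_pairsP rl)[[c1 c2] _ _ _ e].
have e' (i : 'I_n) : nth 0%N nu i = (nth 0 lam i + (i \in p.1) + (i \in p.2))%N.
  by rewrite e !inrowE.
have FE i : (i \in F) = (i \in p.1) (+) (i \in p.2).
  by rewrite inE e'; case: (i \in p.1); case: (i \in p.2) => /=; lia.
have DE i : (i \in D) = (i \in p.1) && (i \in p.2).
  by rewrite inE e'; case: (i \in p.1); case: (i \in p.2) => /=; lia.
split.
- by move=> i; rewrite e'; case: (i \in p.1); case: (i \in p.2) => /=; lia.
- have -> : D = p.1 :&: p.2 by apply/setP => i; rewrite DE inE.
  have -> : F = (p.1 :\: p.2) :|: (p.2 :\: p.1).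
    by apply/setP => i; rewrite FE in_setU !in_setD; case: (i \in p.1); case: (i \in p.2).
  rewrite cardsU (_ : _ :&: _ = set0) ?cards0 ?subn0; last first.
    by apply/setP => i; rewrite in_setI !in_setD in_set0; case: (i \in p.1); case: (i \in p.2).
  rewrite -c1 -c2 -(cardsID p.2 p.1) -(cardsID p.1 p.2) [p.2 :&: p.1]setIC; lia.
- apply/setP => i; rewrite in_setU in_setI FE DE; by case: (i \in p.1); case: (i \in p.2).
- apply/setP => i; rewrite in_setU in_setD FE DE; by case: (i \in p.1); case: (i \in p.2).
Qed.

Section Strips.
Variables (n k : nat) (lam nu : seq nat).
Hypotheses (n_gt0 : (0 < n)%N) (k_gt0 : (0 < k)%N).
Hypotheses (lam_res : restricted n k lam) (nu_res : restricted n k nu).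

Local Notation F := (free_rows n lam nu).
Local Notation D := (double_rows n lam nu).
Local Notation glue := (@same_column n lam nu).
Local Notation adm := (admissible F glue).

Let pl : is_part lam. Proof. by case/and3P: lam_res. Qed.
Let sl : (size lam <= n)%N. Proof. by case/and3P: lam_res. Qed.
Let pn : is_part nu. Proof. by case/and3P: nu_res. Qed.
Let sn : (size nu <= n)%N. Proof. by case/and3P: nu_res. Qed.

(** If the level rises to k + 1 at eta, it falls back at nu, so the rows 0 and
    [n.-1] have exactly one box each, in the first and in the second strip. *)
Lemma mid_restricted (J : {set 'I_n}) : 
  (forall i : 'I_n, (nth 0 lam i <= nth 0 nu i <= (nth 0 lam i).+2)%N) ->
  J \subset F -> vstrip lam (J :|: D) ->
  restricted n k (add_strip lam (J :|: D)) = ~~ (wraps n k lam nu && wrong_wrap J).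
Proof.
move=> box sub v; rewrite /restricted add_strip_part // size_add_strip /= /part !nth_add_strip //=.
have ltl : (n.-1 < n)%N by rewrite prednK.
pose z := Ordinal n_gt0; pose l := Ordinal ltl.
have Ez (I : {set 'I_n}) : inrow I 0 = (z \in I) by rewrite -inrowE.
have El (I : {set 'I_n}) : inrow I n.-1 = (l \in I) by rewrite -inrowE.
rewrite /wraps /wrong_wrap !Ez !El !in_setU.
have zJ : z \in J -> nth 0%N nu 0%N = (nth 0%N lam 0%N).+1.
  by move/(subsetP sub); rewrite inE => /eqP.
have lJ : l \in J -> nth 0%N nu n.-1 = (nth 0%N lam n.-1).+1.
  by move/(subsetP sub); rewrite inE => /eqP.
have zD : (z \in D) = (nth 0%N nu 0%N == (nth 0%N lam 0%N).+2) by rewrite inE.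
have lD : (l \in D) = (nth 0%N nu n.-1 == (nth 0%N lam n.-1).+2) by rewrite inE.
have bz := box z; have bl := box l; rewrite /= in bz bl.
have := part_nth_le pl (leq0n n.-1); have := part_nth_le pn (leq0n n.-1).
have : (nth 0 lam 0 - nth 0 lam n.-1 <= k)%N by case/and3P: lam_res.
have : (nth 0 nu 0 - nth 0 nu n.-1 <= k)%N by case/and3P: nu_res.
rewrite zD lD; move: zJ lJ bz bl.
move: (nth 0%N nu 0%N) (nth 0%N nu n.-1) (nth 0%N lam 0%N) (nth 0%N lam n.-1).
case: (z \in J); case: (l \in J); clear; move=> a b c d; lia.
Qed.

(** The pair is recovered from [J] since each strip contains all double rows. *)
Lemma strip_pairs_count (Q : pred {set 'I_n}) a b :
  (forall i : 'I_n, (nth 0 lam i <= nth 0 nu i <= (nth 0 lam i).+2)%N) ->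
  (#|F| + 2 * #|D| = a + b)%N ->
  #|[set p in strip_pairs n k lam nu a b | Q (p.1 :&: F)]|
  = #|[set J | adm J & (#|J| + #|D| == a)%N && (~~ (wraps n k lam nu && wrong_wrap J) && Q J)]|.
Proof.
move=> box sz.
have FD (J : {set 'I_n}) : J \subset F -> (J :|: D) :&: F = J.
  move=> sub; apply/setP => i; rewrite in_setI in_setU.
  have [iJ|iJ] /= := boolP (i \in J); first exact: (subsetP sub).
  by rewrite !inE; lia.
have cFD (J : {set 'I_n}) : J \subset F -> #|J :|: D| = (#|J| + #|D|)%N.
  move=> sub; rewrite cardsU (_ : J :&: D = set0) ?cards0 ?subn0 //.
  apply/setP => i; rewrite in_setI in_set0; apply/negP => /andP[/(subsetP sub)].
  by rewrite !inE; lia.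
apply: (card_bij (e := fun p => p.1 :&: F) (f := fun J => (J :|: D, (F :\: J) :|: D))).
  move=> p; rewrite inE => /andP[pX Qp]; have [_ _ e1 e2] := strip_rows lam_res pX.
  have [[c1 c2] v1 r1 v2 e] := strip_pairsP lam_res pX.
  have subF : p.1 :&: F \subset F by apply: subsetIr.
  split; last first.
    by rewrite -e1 setDIr setDv setU0 -e2; case: (p).
  rewrite inE Qp andbT; apply/and3P; split.
  - apply/admissibleP; split=> // i j /and4P[/eqP ji iF jF /eqP lij].
    rewrite !in_setI iF andbT => /andP[jp _].
    have := vstripP p.1 sl v1 i; rewrite -ji lij !inrowE jp; by case: (i \in p.1) => //=; rewrite addn0 addn1 ltnn.
  - by rewrite -cFD // -e1 c1.
  - by rewrite -mid_restricted // -e1.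
move=> J; rewrite inE => /and3P[aJ /eqP cJ /andP[wJ QJ]]; have /admissibleP[sub hJ] := aJ.
rewrite /= FD //; split=> //; rewrite inE /= FD // QJ andbT.
have inr (i : nat) (lt : (i < n)%N) (I : {set 'I_n}) : inrow I i = (Ordinal lt \in I) by rewrite -inrowE.
have v1 : vstrip lam (J :|: D).
  apply/vstripP => // r; have := part_nth_le pl (leqnSn r).
  rewrite leq_eqVlt => /orP[/eqP e|]; last by case: inrow; case: inrow; clear; lia.
  rewrite e leq_add2l; case lt : (r.+1 < n)%N; last by rewrite (@inrow_out _ _ r.+1) // leqNgt lt.
  rewrite (inr _ lt) (inr _ (ltnW lt)) !in_setU.
  have [jD|jD] := boolP (Ordinal lt \in D).
    suff -> : Ordinal (ltnW lt) \in D by rewrite !orbT.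
    move: jD (box (Ordinal (ltnW lt))); rewrite !inE /= e; have := part_nth_le pn (leqnSn r); clear; lia.
  have [jJ|//] := boolP (Ordinal lt \in J).
  have := subsetP sub _ jJ; rewrite inE /= => jF.
  have [//|iD] := boolP (Ordinal (ltnW lt) \in D); first by rewrite orbT.
  rewrite (hJ (Ordinal (ltnW lt)) (Ordinal lt)) //; apply/and4P; split=> //=.
  - move: jF iD (box (Ordinal (ltnW lt))); rewrite !inE /= e; have := part_nth_le pn (leqnSn r); clear; lia.
  - by rewrite inE.
  - by rewrite e.
have e r : nth 0%N nu r = (nth 0 lam r + inrow (J :|: D) r + inrow ((F :\: J) :|: D) r)%N.
  case: (ltnP r n) => [lt|ge]; last by rewrite !inrow_out // !nth_default // (leq_trans _ ge).
  rewrite !(inr _ lt) !in_setU in_setD.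
  have := box (Ordinal lt); have := @subsetP _ _ _ sub (Ordinal lt).
  by rewrite !inE /=; case: (Ordinal lt \in J) => /=; [move=> /(_ isT) | move=> _]; clear; lia.
have s1 := size_add_strip lam (J :|: D).
have v2 : vstrip (add_strip lam (J :|: D)) ((F :\: J) :|: D).
  by apply/vstripP => // r; rewrite !nth_add_strip // -!e part_nth_le.
have nuE : add_strip (add_strip lam (J :|: D)) ((F :\: J) :|: D) = nu.
  by apply: part_ext => //; rewrite ?add_strip_part // => r; rewrite nth_add_strip // nth_add_strip // e.
rewrite inE /two_strips /= nuE eqxx andbT v1 v2 nu_res mid_restricted // wJ cFD // cJ eqxx /= andbT.
rewrite cFD ?subsetDl // cardsD (setIidPr sub); apply/eqP.
by move: (subset_leq_card sub) cJ sz; clear; lia.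
Qed.

(** Admissible sets split into those giving restricted chains and those wrapping
    wrongly; [lattice_count] applies to all of them, [wrap_difference] to the
    latter.  Lattice words never wrap wrongly, since their first letter is a left
    parenthesis. *)
Lemma strip_pairs_diff a b : (0 < b <= a)%N ->
  #|strip_pairs n k lam nu a b| = (#|strip_pairs n k lam nu a.+1 b.-1|
    + #|[set p in strip_pairs n k lam nu a b |
          lattice F (p.1 :&: F) && ~~ excluded k lam nu (p.1 :&: F)]|)%N.
Proof.
move=> /andP[b0 ba].
have [U0|/set0Pn[p0]] := eqVneq (strip_pairs n k lam nu a b :|: strip_pairs n k lam nu a.+1 b.-1) set0.
  have /andP[/eqP X0 /eqP X1] : (strip_pairs n k lam nu a b == set0) && (strip_pairs n k lam nu a.+1 b.-1 == set0).
    by rewrite -setU_eq0 U0.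
  rewrite X0 X1 !cards0; apply/esym/eqP; rewrite cards_eq0; apply/eqP/setP => p.
  by rewrite !inE.
rewrite in_setU => p0P.
have [box sz] : (forall i : 'I_n, (nth 0 lam i <= nth 0 nu i <= (nth 0 lam i).+2)%N)
    /\ (#|F| + 2 * #|D| = a + b)%N.
  by case/orP: p0P => /(strip_rows lam_res)[h1 h2 _ _]; split=> //; rewrite h2; lia.
have sz' : (#|F| + 2 * #|D| = a.+1 + b.-1)%N by rewrite sz; lia.
have XT c d : strip_pairs n k lam nu c d = [set p in strip_pairs n k lam nu c d | predT (p.1 :&: F)].
  by apply/setP => p; rewrite [in RHS]inE andbT.
rewrite (strip_pairs_count (fun J => lattice F J && ~~ excluded k lam nu J) box sz).
rewrite (XT a b) (XT a.+1) (strip_pairs_count predT box sz) (strip_pairs_count predT box sz').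
have Da : (#|D| <= a)%N by lia.
pose s := (a - #|D|)%N.
have as_ (J : {set 'I_n}) : (#|J| + #|D| == a)%N = (#|J| == s) by rewrite /s; lia.
have aS (J : {set 'I_n}) : (#|J| + #|D| == a.+1)%N = (#|J| == s.+1) by rewrite /s; lia.
have Fs : (#|F| <= 2 * s)%N by rewrite /s; lia.
have main := lattice_count (@same_column_free n lam nu) Fs.
have [wr|nw] := boolP (wraps n k lam nu); last first.
  rewrite (_ : [set J | _ & _] = [set J | adm J & #|J| == s]); last first.
    by apply/setP => J; rewrite !inE as_ /= andbT.
  rewrite main; congr (_ + _)%N; apply: eq_card => J; rewrite !inE /excluded ?(negbTE nw) ?as_ ?aS /=.
    by rewrite -?andbA ?andbT.
  by rewrite -?andbA ?andbT.
have ltl : (n.-1 < n)%N by rewrite prednK.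
have s0 : (0 < s)%N.
  have : (0 < #|F|)%N by rewrite card_gt0; apply/set0Pn; exists (Ordinal n_gt0); rewrite inE; case/and3P: wr.
  by lia.
case: s s0 as_ aS Fs main => // s _ as_ aS Fs main.
have wd := wrap_difference n_gt0 k_gt0 pl pn wr Fs.
have split1 t : #|[set J | adm J & #|J| == t]| =
   (#|[set J | adm J & (#|J| == t) && wrong_wrap J]| + #|[set J | adm J & (#|J| == t) && ~~ wrong_wrap J]|)%N.
  rewrite -(cardsID [set J | wrong_wrap J]); congr (_ + _)%N; apply: eq_card => J; rewrite !inE;
    by case: (adm J); case: (_ == _); case: (wrong_wrap J).
have latW (J : {set 'I_n}) : lattice F J -> ~~ wrong_wrap J.
  move=> la; rewrite /wrong_wrap negb_and negbK; apply/orP; right.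
  rewrite -[n.-1]/(nat_of_ord (Ordinal ltl)) inrowE; move/forallP: la => /(_ (Ordinal ltl)).
  rewrite heightS height_out; last by rewrite /= prednK.
  have -> : Ordinal ltl \in F by rewrite inE; case/and3P: wr.
  by case: (_ \in J).
have split2 : #|[set J | adm J & (#|J| == s.+1) && lattice F J]| =
   (#|[set J | adm J & (#|J| == s.+1) && (lattice F J && excluded k lam nu J)]| +
    #|[set J | adm J & (#|J| == s.+1) && (~~ wrong_wrap J && (lattice F J && ~~ excluded k lam nu J))]|)%N.
  rewrite -(cardsID [set J | excluded k lam nu J]); congr (_ + _)%N; apply: eq_card => J; rewrite !inE;
  move: (latW J); case: (adm J); case: (_ == _); case: (lattice F J); case: (excluded _ _ _ _);
    by case: (wrong_wrap J) => // /(_ isT).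
move: main; rewrite !split1 split2 wd.
have -> : [set J | adm J & (#|J| + #|D| == a)%N && (~~ (true && wrong_wrap J) && predT J)]
   = [set J | adm J & (#|J| == s.+1) && ~~ wrong_wrap J] by apply/setP => J; rewrite !inE as_ /= andbT.
have -> : [set J | adm J & (#|J| + #|D| == a.+1)%N && (~~ (true && wrong_wrap J) && predT J)]
   = [set J | adm J & (#|J| == s.+2) && ~~ wrong_wrap J] by apply/setP => J; rewrite !inE aS /= andbT.
have -> : [set J | adm J & (#|J| + #|D| == a)%N && (~~ (true && wrong_wrap J) && (lattice F J && ~~ excluded k lam nu J))]
   = [set J | adm J & (#|J| == s.+1) && (~~ wrong_wrap J && (lattice F J && ~~ excluded k lam nu J))].
  by apply/setP => J; rewrite !inE as_.
clear; lia.
Qed.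

End Strips.

(** * Decreasing paths and vertical strips *)

Lemma is_part_nth s : (forall i, nth 0 s i.+1 <= nth 0 s i)%N ->
  (forall i, (i < size s)%N -> (0 < nth 0 s i)%N) -> is_part s.
Proof.
move=> h1 h2; apply/andP; split; first by apply/(sortedP 0%N) => i _; apply: h1.
by apply/negP => /(nthP 0%N)[i /h2]; rewrite lt0n => /eqP.
Qed.

Lemma added_box_incr la r : added_box la (incr_nth la r) = ((nth 0 la r).+1, r.+1)%N.
Proof.
set mu := incr_nth la r; have rs : (r < size mu)%N.
  by rewrite /mu size_incr_nth; case: (ltnP r (size la)).
have -> : added_box la mu = (part mu r.+1, r.+1).
  rewrite /added_box; suff -> : find (fun j => (part la j < part mu j)%N) (iota 1 (size mu)) = r by [].
  transitivity (find (pred1 r.+1) (iota 1 (size mu))).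
    apply: eq_in_find => j; rewrite mem_iota => /andP[j0 _].
    rewrite /part nth_incr_nth -[in RHS](prednK j0) /= eqSS eq_sym; case: eqP => _; lia.
  have := index_uniq 0%N _ (iota_uniq 1 (size mu)) => /(_ r).
  by rewrite size_iota nth_iota // add1n => /(_ rs).
by rewrite /part /= nth_incr_nth eqxx.
Qed.

Lemma adds_boxP la mu : adds_box la mu -> exists r, mu = incr_nth la r.
Proof. by case/and3P=> _ _ /hasP[r _ /eqP ->]; exists r. Qed.

(** The label of an added box decreases exactly when its row lies above that of
    the preceding box. *)
Lemma decreasing_rows lam p : path adds_box lam p -> decreasing lam p ->
  exists2 rs, sorted ltn rs & p = scanl incr_nth lam rs.
Proof.
elim: p lam => [|ka p IH] lam /=; first by exists [::].
case/andP=> hk hp hd; have [r kE] := adds_boxP hk.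
have pl : is_part lam by case/and3P: hk.
have hd' : decreasing ka p by move: hd; rewrite /decreasing /labels /= => /path_sorted.
have [rs so pE] := IH _ hp hd'; exists (r :: rs); last by rewrite /= -kE pE.
case: rs so pE => [|r' rs] //= so pE; rewrite so andbT.
move: hd; rewrite pE /decreasing /labels /boxes /= => /andP[+ _].
rewrite kE !added_box_incr /label /= nth_incr_nth.
move=> hlt; rewrite ltnNge; apply/negP => le.
by move: hlt le (part_nth_le pl le); case: eqP => [->|_]; clear; lia.
Qed.

(** Adding the boxes of a vertical strip from the lowest row upwards passes only
    through partitions. *)
Lemma chain_vstrip lam rs : is_part lam -> sorted ltn rs ->
  (forall r, nth 0 lam r.+1 + (r.+1 \in rs) <= nth 0 lam r + (r \in rs))%N ->
  let p := scanl incr_nth lam rs in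
  [/\ path adds_box lam p, boxes lam p = [seq ((nth 0 lam r).+1, r.+1)%N | r <- rs],
      is_part (last lam p)
    & forall r, nth 0%N (last lam p) r = (nth 0 lam r + (r \in rs))%N].
Proof.
elim: rs lam => [|r rs IH] lam pl so h /=; first by split=> // r; rewrite addn0.
set ka := incr_nth lam r.
have so' := path_sorted so; have rlt : {in rs, forall r', (r < r')%N}.
  by apply/allP; apply: order_path_min so => a b c; apply: ltn_trans.
have rrs : r \notin rs by apply/negP => /rlt; rewrite ltnn.
have kE i : (nth 0 ka i + (i \in rs) = nth 0 lam i + (i \in r :: rs))%N.
  rewrite nth_incr_nth inE eq_sym; case: eqP => [->|_]; last by rewrite add0n.
  by rewrite (negbTE rrs) addn0 addn1.
have kb r' : (r' < r)%N -> (nth 0 ka r' = nth 0 lam r')%N /\ (r' \in r :: rs) = false.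
  move=> lt; rewrite nth_incr_nth gtn_eqF //; split=> //; rewrite inE ltn_eqF //=.
  by apply/negP => /rlt; rewrite ltnNge ltnW.
have step r' : r'.+1 = r -> (nth 0 lam r < nth 0 lam r')%N.
  by move=> e; have := h r'; rewrite e inE eqxx (kb r' _).2 -?e // addn0 addn1.
have rs_ : (r <= size lam)%N.
  by case: r step {so rlt rrs ka kE kb h} => // r /(_ r erefl); rewrite -part_nth_gt0 //; apply: leq_ltn_trans.
have pk : is_part ka.
  apply: is_part_nth => i.
    have := part_nth_le pl (leqnSn i); rewrite !nth_incr_nth.
    have [e|ne] := eqVneq r i.+1; last by move=> h'; rewrite add0n; apply: leq_trans h' (leq_addl _ _).
    by have := step i (esym e); rewrite -e => lt _; rewrite add1n; apply: leq_trans lt (leq_addl _ _).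
  rewrite size_incr_nth nth_incr_nth; case: (ltnP r (size lam)) => hr.
    by rewrite -part_nth_gt0 // => h0; apply: leq_trans h0 (leq_addl _ _).
  rewrite ltnS leq_eqVlt => /orP[/eqP->|lt]; first by rewrite eqxx.
  by apply: leq_trans (leq_addl _ _); rewrite part_nth_gt0 //; apply: leq_trans lt rs_.
have hk i : (nth 0 ka i.+1 + (i.+1 \in rs) <= nth 0 ka i + (i \in rs))%N by rewrite !kE.
have [h1 h2 h3 h4] := IH ka pk so' hk; split=> //.
- rewrite h1 andbT /adds_box pl pk !andTb; apply/hasP; exists r => //.
  by rewrite mem_iota /= add0n ltnS.
- rewrite /boxes /= added_box_incr; congr cons; rewrite -/(boxes ka _) h2.
  apply/eq_in_map => r' /rlt lt; by rewrite nth_incr_nth ltn_eqF.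
by move=> i; rewrite h4 kE.
Qed.

Definition rows n (I : {set 'I_n}) : seq nat := [seq r <- iota 0 n | inrow I r].

Lemma mem_rows n (I : {set 'I_n}) r : (r \in rows I) = inrow I r.
Proof.
rewrite mem_filter mem_iota /= add0n; case: (ltnP r n) => [|/(inrow_out I) ->] //.
by rewrite andbT.
Qed.

Lemma rows_sorted n (I : {set 'I_n}) : sorted ltn (rows I).
Proof. by apply: sorted_filter; [apply: ltn_trans | apply: iota_ltn_sorted]. Qed.

Lemma size_rows n (I : {set 'I_n}) : size (rows I) = #|I|.
Proof.
rewrite cardE -(size_map val); apply: perm_size; apply: uniq_perm.
- by rewrite filter_uniq ?iota_uniq.
- by rewrite map_inj_uniq ?enum_uniq //; apply: val_inj.
by move=> r; rewrite mem_rows.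
Qed.

Definition path_of n (lam : seq nat) (p : {set 'I_n} * {set 'I_n}) : cpath :=
  (scanl incr_nth lam (rows p.1), scanl incr_nth (add_strip lam p.1) (rows p.2)).

Lemma rows_vstrip n lam (I : {set 'I_n}) : is_part lam -> (size lam <= n)%N -> vstrip lam I ->
  let p := scanl incr_nth lam (rows I) in
  [/\ path adds_box lam p, boxes lam p = [seq ((nth 0 lam r).+1, r.+1)%N | r <- rows I],
      last lam p = add_strip lam I & size p = #|I|].
Proof.
move=> pl sl v; have h r : (nth 0 lam r.+1 + (r.+1 \in rows I) <= nth 0 lam r + (r \in rows I))%N.
  by rewrite !mem_rows; apply: (vstripP I sl v).
have [h1 h2 h3 h4] := chain_vstrip pl (rows_sorted I) h; split=> //.
  by apply: part_ext => // [|r]; rewrite ?add_strip_part // h4 nth_add_strip // mem_rows.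
by rewrite size_scanl size_rows.
Qed.

Lemma decreasing_rows_path n lam (I : {set 'I_n}) : is_part lam -> (size lam <= n)%N -> vstrip lam I ->
  decreasing lam (scanl incr_nth lam (rows I)).
Proof.
move=> pl sl v; have [_ e _ _] := rows_vstrip pl sl v.
rewrite /decreasing /labels e -map_comp sorted_map.
apply: sub_sorted (rows_sorted I) => i j ij /=; rewrite /label /=.
by move: ij (part_nth_le pl (ltnW ij)); clear; lia.
Qed.

Lemma decreasing_path_vstrip n lam p : is_part lam -> (size lam <= n)%N ->
  path adds_box lam p -> decreasing lam p -> (size (last lam p) <= n)%N ->
  exists2 I : {set 'I_n}, vstrip lam I & p = scanl incr_nth lam (rows I).
Proof.
move=> pl sl pp dp sp; have [rs so pE] := decreasing_rows pp dp.
have lastE : forall rs lam r, nth 0%N (last lam (scanl incr_nth lam rs)) r = (nth 0 lam r + count_mem r rs)%N.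
  clear; elim=> [|a rs IH] lam r /=; first by rewrite addn0.
  by rewrite IH nth_incr_nth addnCA addnA.
have plast : is_part (last lam p).
  case/lastP: p pp {dp sp pE} => // p x; rewrite rcons_path last_rcons => /andP[_].
  by case/and3P.
have urs : uniq rs by apply: (sorted_uniq ltn_trans ltnn).
have lE r : nth 0%N (last lam p) r = (nth 0 lam r + (r \in rs))%N.
  by rewrite pE lastE count_uniq_mem.
have rsn r : r \in rs -> (r < n)%N.
  move=> rr; apply: leq_trans sp; rewrite -part_nth_gt0 // lE rr; lia.
pose I : {set 'I_n} := [set i : 'I_n | (i : nat) \in rs].
have inI r : inrow I r = (r \in rs).
  have [lt|ge] := ltnP r n; first by rewrite (inrowE I (Ordinal lt)) inE.
  by rewrite inrow_out //; apply/esym/negP => /rsn; rewrite ltnNge ge.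
exists I; first by apply/vstripP => // r; rewrite !inI -!lE part_nth_le.
rewrite pE; congr scanl; apply: (irr_sorted_eq ltn_trans ltnn so (rows_sorted I)) => r.
by rewrite mem_rows inI.
Qed.

Lemma in_paths_strips n k lam mu nu P : in_paths n k lam mu nu P ->
  exists2 p, p \in strip_pairs n k lam nu (conj_part mu 1) (conj_part mu 2) & P = path_of lam p.
Proof.
case: P => P1 P2 /and5P[/andP[p1 p2] /eqP e /andP[d1 d2] /eqP c1 /andP[/eqP c2 /and3P[rl rm rn]]].
rewrite /mid /= in p1 p2 e d1 d2 c1 c2 rm.
have /and3P[pl sl _] := rl; have /and3P[pm sm _] := rm; have /and3P[pn sn _] := rn.
have [I v1 e1] := decreasing_path_vstrip pl sl p1 d1 sm.
have [_ _ l1 z1] := rows_vstrip pl sl v1; rewrite -e1 in l1 z1.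
rewrite l1 in p2 d2 e pm sm rm.
have sn' : (size (last (add_strip lam I) P2) <= n)%N by rewrite e.
have [J v2 e2] := decreasing_path_vstrip pm sm p2 d2 sn'.
have [_ _ l2 z2] := rows_vstrip pm sm v2; rewrite -e2 e in l2 z2.
exists (I, J); last by rewrite /path_of /= -e1 -e2.
by rewrite inE /two_strips /= -z1 c1 -z2 c2 !eqxx v1 rm v2 -l2 rn eqxx.
Qed.

Lemma strips_in_paths n k lam mu nu p : restricted n k lam -> restricted n k nu ->
  p \in strip_pairs n k lam nu (conj_part mu 1) (conj_part mu 2) ->
  [/\ in_paths n k lam mu nu (path_of lam p), mid lam (path_of lam p) = add_strip lam p.1,
      boxes1 lam (path_of lam p) = [seq ((nth 0 lam r).+1, r.+1)%N | r <- rows p.1]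
    & boxes2 lam (path_of lam p) = [seq ((nth 0 (add_strip lam p.1) r).+1, r.+1)%N | r <- rows p.2]].
Proof.
move=> rl rn pX; have [[c1 c2] v1 r1 v2 _] := strip_pairsP rl pX.
have /and3P[pl sl _] := rl; have /and3P[pm sm _] := r1.
have [a1 b1 l1 z1] := rows_vstrip pl sl v1; have [a2 b2 l2 z2] := rows_vstrip pm sm v2.
have m1 : mid lam (path_of lam p) = add_strip lam p.1 by [].
split=> //; last by rewrite /boxes2 m1.
rewrite /in_paths m1 /= a1 a2 l2 !decreasing_rows_path // z1 z2 c1 c2 !eqxx rl r1 rn /=.
by move: pX; rewrite inE => /andP[_ ->].
Qed.

Lemma path_of_inj n k lam nu a b : restricted n k lam -> restricted n k nu ->
  {in strip_pairs n k lam nu a b &, injective (path_of lam)}.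
Proof.
move=> rl rn p q pX qX [e1 e2]; have [_ v1 _ _ _] := strip_pairsP rl pX.
have [_ w1 _ _ _] := strip_pairsP rl qX; have /and3P[pl sl _] := rl.
have [_ _ l1 _] := rows_vstrip pl sl v1; have [_ _ m1 _] := rows_vstrip pl sl w1.
have e : p.1 = q.1.
  apply/setP => i; have : nth 0%N (add_strip lam p.1) i = nth 0%N (add_strip lam q.1) i.
    by rewrite -l1 -m1 e1.
  by rewrite !nth_add_strip // !inrowE => /eqP; rewrite eqn_add2l; case: (i \in p.1); case: (i \in q.1).
have [_ _ _ p2] := strip_rows rl pX; have [_ _ _ q2] := strip_rows rl qX.
by case: p q e p2 q2 {e1 e2 pX qX v1 w1 l1 m1} => p1 p2 [q1 q2] /= -> -> ->.
Qed.

(** * Matching of parentheses *)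

Definition balance (w : seq letter) : int := (count (fun z => z.2) w)%:Z - (count (fun z => ~~ z.2) w)%:Z.

Lemma balance_cons z w : balance (z :: w) = (if z.2 then 1 else -1) + balance w.
Proof. by rewrite /balance /=; case: z.2 => /=; move: (count _ _) (count _ _); clear; lia. Qed.

Lemma balance_cat u v : balance (u ++ v) = balance u + balance v.
Proof. by elim: u => [|z u IH]; rewrite /= ?balance_cons ?IH ?addrA // add0r. Qed.

Lemma pairing_cat st u w : exists st', {subset pairing st' w <= pairing st (u ++ w)}.
Proof.
elim: u st => [|z u IH] st /=; first by exists st.
case: z.2; first exact: IH.
case: st => [|y st]; first exact: IH.
by have [st' h] := IH st; exists st' => a /h aa; rewrite inE aa orbT.
Qed.

(** The letters [st1] lie above [x] on the stack, so [x] is reached when they and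
    the left parentheses of [v] have been matched. *)
Lemma pairing_stack (st1 st' v t : seq letter) (x y : letter) : ~~ y.2 ->
  (forall i, 0 <= (size st1)%:Z + balance (take i v)) -> (size st1)%:Z + balance v = 0 ->
  (x, y) \in pairing (st1 ++ x :: st') (v ++ y :: t).
Proof.
move=> yF; elim: v st1 => [|z v IH] st1 h0 h1.
  move: h1; rewrite /balance /= (negbTE yF) subrr addr0; case: st1 {h0} => //= _.
  by rewrite mem_head.
have hz i := h0 i.+1; rewrite /=; case zT : z.2.
  apply: (IH (z :: st1)) => [i|].
    by have := hz i; rewrite /= balance_cons zT; move: (balance _) => H; clear; lia.
  by move: h1; rewrite balance_cons zT /=; move: (balance _) => H; clear; lia.
case: st1 h1 hz {h0} => [|z' st1] h1 hz.
  by have := hz 0%N; rewrite /= take0 balance_cons zT /balance.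
rewrite inE; apply/orP; right; apply: IH => [i|].
  by have := hz i; rewrite /= balance_cons zT; move: (balance _) => H; clear; lia.
by move: h1; rewrite balance_cons zT /=; move: (balance _) => H; clear; lia.
Qed.

Lemma pairing_dyck (u v t : seq letter) (x y : letter) : x.2 -> ~~ y.2 ->
  (forall i, 0 <= balance (take i v)) -> balance v = 0 ->
  (x, y) \in pairing [::] (u ++ x :: v ++ y :: t).
Proof.
move=> xT yF h0 h1; have [st' h] := pairing_cat [::] u (x :: v ++ y :: t).
apply: h; rewrite /= xT; apply: (@pairing_stack [::]) => // [i|]; by rewrite add0r.
Qed.

(** The match of [x] is where the balance first becomes negative. *)
Lemma pairing_below (u v : seq letter) (x : letter) i : x.2 -> balance (take i v) < 0 ->
  exists y, (x, y) \in pairing [::] (u ++ x :: v).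
Proof.
move=> xT hi; pose P j := balance (take j v) < 0.
have exP : exists j, P j by exists i.
case: (ex_minnP exP) => j Pj jmin.
have j0 : (0 < j)%N by rewrite lt0n; apply: contraTneq Pj => ->; rewrite /P take0.
have jv : (j.-1 < size v)%N.
  rewrite ltnNge; apply/negP => h; have := jmin j.-1; rewrite /P take_oversize //.
  move: Pj; rewrite /P take_oversize; last exact: leq_trans h (leq_pred _).
  by move=> -> /(_ isT); move: j0; clear; case: j => //= j _; rewrite ltnn.
pose y := nth (0, true) v j.-1.
have vE : v = take j.-1 v ++ y :: drop j v.
  by rewrite -[in LHS](cat_take_drop j.-1 v) (drop_nth (0, true) jv) prednK.
have pre l : (l < j)%N -> 0 <= balance (take l v).
  by move=> lj; rewrite leNgt; apply/negP => /jmin; rewrite leqNgt lj.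
have hj : balance (take j v) = balance (take j.-1 v) + (if y.2 then 1 else -1).
  by rewrite -[in LHS](prednK j0) (take_nth (0, true) jv) -cats1 balance_cat balance_cons {2}/balance /= addr0.
have h1 := pre j.-1; rewrite prednK // leqnn in h1; have {}h1 := h1 isT.
move: Pj; rewrite /P hj => Pj; exists y.
have yF : ~~ y.2 by apply/negP => yT; move: Pj h1; rewrite yT; move: (balance _) => H; clear; lia.
have hv0 : balance (take j.-1 v) = 0.
  by move: Pj h1; rewrite (negbTE yF); move: (balance _) => H; clear; lia.
rewrite vE; apply: pairing_dyck => // l; have [lj|jl] := leqP l j.-1.
  rewrite take_takel //; apply: pre; move: lj j0; clear; lia.
by rewrite take_oversize ?hv0 // size_take jv; apply: ltnW.
Qed.

(** A pair is formed either within the word or with a letter already on the stack;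
    in both cases the letters in between are balanced. *)
Lemma pairing_split st w (x y : letter) : (x, y) \in pairing st w ->
  (exists u v t, [/\ w = u ++ x :: v ++ y :: t, x.2, ~~ y.2, forall i, 0 <= balance (take i v) & balance v = 0])
  \/ (exists st1 st' v t, [/\ st = st1 ++ x :: st', w = v ++ y :: t, ~~ y.2,
       forall i, 0 <= (size st1)%:Z + balance (take i v) & (size st1)%:Z + balance v = 0]).
Proof.
elim: w st => //= z w IH st; case zT : z.2.
  move/IH; case=> [[u [v [t [-> h1 h2 h3 h4]]]]|[st1 [st' [v [t [e1 -> h2 h3 h4]]]]]].
    by left; exists (z :: u), v, t.
  case: st1 e1 h3 h4 => [|z1 st1] /= [e1 e2] h3 h4.
    rewrite -e1; left; exists [::], v, t; split=> // [i|]; last by rewrite -h4 add0r.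
    by rewrite -[balance _]add0r.
  right; exists st1, st', (z :: v), t; split=> // [[|i]|].
  - by rewrite take0 {1}/balance /= subrr addr0.
  - have := h3 i; rewrite /= balance_cons zT; move: (balance _) => H; clear; lia.
  by move: h4; rewrite balance_cons zT; move: (balance _) => H; clear; lia.
case: st => [|y0 st].
  move/IH; case=> [[u [v [t [-> h1 h2 h3 h4]]]]|[[|? ?] [st' [v [t []]]]]] //.
  by left; exists (z :: u), v, t.
rewrite inE => /orP[/eqP[-> ->]|xy].
  right; exists [::], st, [::], w; rewrite zT; split=> //.
case/IH: xy => [[u [v [t [-> h1 h2 h3 h4]]]]|[st1 [st' [v [t [-> -> h2 h3 h4]]]]]].
  by left; exists (z :: u), v, t.
right; exists (y0 :: st1), st', (z :: v), t; split=> // [[|i]|].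
- by rewrite take0 {1}/balance /= subrr addr0.
- have := h3 i; rewrite /= balance_cons zT; move: (balance _) => H; clear; lia.
by move: h4; rewrite balance_cons zT /=; move: (balance _) => H; clear; lia.
Qed.

Lemma pairing_splitP w (x y : letter) : (x, y) \in pairing [::] w ->
  exists u v t, [/\ w = u ++ x :: v ++ y :: t, x.2, ~~ y.2, forall i, 0 <= balance (take i v) & balance v = 0].
Proof. by case/pairing_split => // -[[|? ?] [? [? [? []]]]]. Qed.

(** * Sorted words *)

Lemma letter_le_trans : transitive letter_le.
Proof.
move=> [b c] [a d] [e f]; rewrite /letter_le /=; case: c; case: d; case: f => /=; lia.
Qed.

Lemma letter_le_total : total letter_le.
Proof.
move=> [a b] [c d]; rewrite /letter_le /=; case: (ltgtP a c) => //= _.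
by case: b; case: d.
Qed.

Lemma letter_le_anti : antisymmetric letter_le.
Proof.
move=> [a b] [c d]; rewrite /letter_le /=; case: (ltgtP a c) => //= ->.
by case: b; case: d.
Qed.

Definition letters (l1 l2 : seq int) : seq letter :=
  sort letter_le ([seq (a, true) | a <- l1] ++ [seq (a, false) | a <- l2]).

(** The balance of the prefix of the word that ends with the label [x]. *)
Definition excess (l1 l2 : seq int) (x : int) : int :=
  (count (fun a => a <= x) l1)%:Z - (count (fun a => a <= x) l2)%:Z.

Lemma letter_le1 (y z : letter) : letter_le y z -> y.1 <= z.1.
Proof. by case/orP => [/ltW|/andP[/eqP-> _]]. Qed.

Section Word.
Variables l1 l2 : seq int.
Hypotheses (u1 : uniq l1) (u2 : uniq l2).
Local Notation W := (letters l1 l2).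
Local Notation H := (excess l1 l2).

Let W_perm : perm_eq W ([seq (a, true) | a <- l1] ++ [seq (a, false) | a <- l2]).
Proof. by rewrite perm_sort. Qed.

Let W_sorted : sorted letter_le W. Proof. exact: sort_sorted letter_le_total _. Qed.

Lemma mem_letters a b : ((a, b) \in W) = if b then a \in l1 else a \in l2.
Proof.
rewrite (perm_mem W_perm) mem_cat; case: b.
  rewrite mem_map; last by move=> ? ? [].
  by rewrite orbC; case: mapP => // -[? _ []].
rewrite [X in _ || X]mem_map; last by move=> ? ? [].
by case: mapP => // -[? _ []].
Qed.

Lemma letters_uniq : uniq W.
Proof.
rewrite (perm_uniq W_perm) cat_uniq !map_inj_uniq //; try by move=> ? ? [].
by rewrite u1 u2 /= andbT; apply/hasPn => _ /mapP[a _ ->]; apply/negP => /mapP[? _ []].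
Qed.

Lemma balance_filter (P : pred letter) :
  balance (filter P W) = (count (fun a => P (a, true)) l1)%:Z - (count (fun a => P (a, false)) l2)%:Z.
Proof.
have cW Q : count Q W = (count (fun a => Q (a, true)) l1 + count (fun a => Q (a, false)) l2)%N.
  by rewrite (seq.permP W_perm) count_cat !count_map.
have c0 (Q : pred int) s : Q =1 pred0 -> count Q s = 0%N.
  by move=> /eq_count ->; rewrite count_pred0.
rewrite /balance !count_filter !cW; congr (_%:Z - _%:Z).
  by rewrite [X in (_ + X)%N]c0 // addn0.
by rewrite [X in (X + _)%N]c0 // add0n.
Qed.

Let before_filter u z v : W = u ++ z :: v -> u = filter (fun z' => letter_le z' z && (z' != z)) W.
Proof.
move=> e; have := W_sorted; have := letters_uniq; rewrite e cat_uniq /= => /and4P[_ /norP[zu _] zv _] so.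
have so' : pairwise letter_le (u ++ z :: v) by rewrite -sorted_pairwise //; apply: letter_le_trans.
move: so'; rewrite pairwise_cat /= => /and4P[/allrelP uz _ /allP zv' _].
rewrite filter_cat /= eqxx andbF -[LHS]cats0; congr (_ ++ _).
  apply/esym/all_filterP/allP => z' z'u; rewrite uz ?mem_head //=.
  by apply: contraNneq zu => <-.
apply/esym/eqP; rewrite -(negbK (_ == _)) -has_filter; apply/hasPn => z' z'v.
rewrite negb_and negbK orbC; case: eqP => //= ne; apply/negP => le; apply: ne.
by apply: letter_le_anti; rewrite le zv'.
Qed.

Let count_pred (x : int) (l : seq int) : uniq l -> (count (fun a : int => (a <= x)%R) l = count (fun a : int => (a <= x - 1)%R) l + (x \in l))%N.
Proof.
move=> ul; rewrite -(count_uniq_mem x ul) -count_predUI.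
rewrite [X in (_ + X)%N](@eq_count _ _ pred0) ?count_pred0 ?addn0; last by move=> a /=; lia.
by apply: eq_count => a /=; lia.
Qed.

(** A left parenthesis precedes the right one with the same label. *)
Lemma before_true u x v : W = u ++ (x, true) :: v -> balance u = H (x - 1).
Proof.
move=> /before_filter ->; rewrite balance_filter /excess; congr (_%:Z - _%:Z).
  by apply: eq_count => a; rewrite /letter_le xpair_eqE /=; lia.
by apply: eq_count => a; rewrite /letter_le xpair_eqE /=; lia.
Qed.

Lemma before_false u x v : W = u ++ (x, false) :: v -> balance u = H x + 1.
Proof.
move=> e; have xl2 : x \in l2.
  by have := mem_letters x false; rewrite e mem_cat mem_head orbT => <-.
rewrite (before_filter e) balance_filter /excess (count_pred x u2) xl2.
have -> : count (fun a => letter_le (a, true) (x, false) && ((a, true) != (x, false))) l1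
    = count (fun a : int => (a <= x)%R) l1.
  by apply: eq_count => a; rewrite /letter_le xpair_eqE /=; lia.
have -> : count (fun a => letter_le (a, false) (x, false) && ((a, false) != (x, false))) l2
    = count (fun a : int => (a <= x - 1)%R) l2.
  by apply: eq_count => a; rewrite /letter_le xpair_eqE /=; lia.
by move: (count _ _) (count _ _); clear; lia.
Qed.

(** Between two labels the balance is least before the left parentheses. *)
Lemma before_ge u z v : W = u ++ z :: v -> H (z.1 - 1) <= balance u.
Proof.
case: z => x [] e; first by rewrite (before_true e).
have xl2 : x \in l2.
  by have := mem_letters x false; rewrite e mem_cat mem_head orbT => <-.
rewrite (before_false e) /excess /= (count_pred x u1) (count_pred x u2) xl2.
by move: (count _ _) (count _ _); clear; case: (x \in l1) => /=; lia.
Qed.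

Let W_threshold x : W = filter (fun z => z.1 <= x) W ++ filter (fun z => ~~ (z.1 <= x)) W.
Proof.
move: W_sorted; move: (W); elim=> //= z w IH so; have so' := path_sorted so.
case: ifP => zx /=; first by rewrite -IH.
have -> : [seq z0 <- w | z0.1 <= x] = [::].
  apply/eqP; rewrite -(negbK (_ == _)) -has_filter; apply/hasPn => z' z'w.
  have /letter_le1 le := allP (order_path_min letter_le_trans so) z' z'w.
  by apply: (contraFN _ zx); apply: le_trans le.
rewrite /=; congr cons; apply/esym/all_filterP/allP => z' z'w.
have /letter_le1 le := allP (order_path_min letter_le_trans so) z' z'w.
by apply: (contraFN _ zx); apply: le_trans le.
Qed.

(** The letters with label at most [x] form a prefix of the word. *)
Lemma threshold_split u a v x : W = u ++ (a, true) :: v -> a <= x ->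
  exists i, balance (take i v) = H x - H (a - 1) - 1
    /\ forall v1 y t, v = v1 ++ y :: t -> x < y.1 -> (i <= size v1)%N.
Proof.
move=> e ax; have hu := before_true e.
have Wx := W_threshold x; set A := filter _ W in Wx; set A' := filter _ W in Wx.
have hA : balance A = H x by rewrite /A balance_filter.
have tA : A = take (size A) W by rewrite Wx take_size_cat.
have dA : A' = drop (size A) W by rewrite Wx drop_size_cat.
have uA : (size u < size A)%N.
  rewrite ltnNge; apply/negP => le.
  have : (a, true) \in A'.
    by rewrite dA e drop_cat; case: ltnP => [_|ge]; rewrite ?mem_cat ?mem_head ?orbT // (_ : size A - size u = 0)%N ?drop0 ?mem_head //; move: le; clear; lia.
  by rewrite mem_filter /= ax.
exists (size A - (size u).+1)%N; split.
  move: hA; rewrite {1}tA e take_cat ltnNge ltnW //= -(subnSK uA) /= balance_cat balance_cons hu /=.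
  by move: (balance _) (H _) (H _); clear; lia.
move=> v1 y t ve xy; rewrite leqNgt; apply/negP => lt.
have : y \in A.
  rewrite tA e ve -cat_rcons catA take_cat; case: ltnP => [lt'|ge].
    move: lt'; rewrite size_cat size_rcons => lt'.
    by move: lt; rewrite ltn_subRL => /(ltn_trans lt'); rewrite ltnn.
  rewrite mem_cat; apply/orP; right; rewrite size_cat size_rcons.
  by move: lt; rewrite ltn_subRL -subn_gt0; case: (_ - _)%N => //= j _; rewrite mem_head.
by rewrite mem_filter leNgt xy.
Qed.

(** Inside the word the balance is least at the end of a label, where it is at least
    the balance after the first letter. *)
Lemma paired_between X Y : X \in l1 -> X \notin l2 -> Y \in l2 -> X < Y ->
  (forall x, X <= x -> x < Y -> H X <= H x) -> H Y + 1 = H X ->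
  ((X, true), (Y, false)) \in pairing [::] W.
Proof.
move=> X1 X2 Y2 XY ge eqY.
have : (X, true) \in W by rewrite mem_letters.
case/splitPr eW : _ / => [u w]; have hu := before_true eW.
have : (Y, false) \in W by rewrite mem_letters.
have := W_sorted; have := letters_uniq; rewrite eW cat_uniq /= => /and4P[_ /norP[zu _] zv _] so.
have so' : pairwise letter_le (u ++ (X, true) :: w) by rewrite -sorted_pairwise //; apply: letter_le_trans.
move: so'; rewrite pairwise_cat /= => /and4P[/allrelP uz _ /allP zv' pw].
rewrite mem_cat inE => /or3P[/uz h||].
- by have := h _ (mem_head _ _); rewrite /letter_le /=; move: XY; clear; lia.
- by case/andP.
move=> yw; move: eW zv zv' pw; case/splitPr: yw => v t eW zv zv' pw.
have eY : W = (u ++ (X, true) :: v) ++ (Y, false) :: t by rewrite eW -catA.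
have hX : H X = H (X - 1) + 1.
  rewrite /excess (count_pred X u1) (count_pred X u2) X1 (negbTE X2).
  by move: (count _ _) (count _ _); clear; lia.
have hv : balance v = 0.
  by have := before_false eY; rewrite balance_cat balance_cons hu /=; move: eqY hX; clear; move: (balance _) (H _) (H _) (H _); lia.
apply: pairing_dyck => // i; have [iv|vi] := ltnP i (size v); last by rewrite take_oversize // hv.
set z := nth (0, true) v i.
have zin : z \in v by apply: mem_nth.
have eZ : W = (u ++ (X, true) :: take i v) ++ z :: (drop i.+1 v ++ (Y, false) :: t).
  by rewrite eW -catA /= -(cat_cons z) -(drop_nth _ iv) (catA (take i v)) cat_take_drop.
have := before_ge eZ; rewrite balance_cat balance_cons hu /=.
have zX : X < z.1.
  have := zv' z; rewrite mem_cat zin => /(_ isT); rewrite /letter_le /=.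
  case/orP => // /andP[/eqP zX _]; have : z \in W by rewrite eZ mem_cat mem_head orbT.
  move: zX zin; case: (z) => [c []] /= <-; last by rewrite mem_letters (negbTE X2).
  by move=> Xv; move: zv; rewrite mem_cat Xv.
have zY : z.1 <= Y.
  move: pw; rewrite pairwise_cat => /and3P[/allrelP h _ _].
  by have := h z (Y, false) zin (mem_head _ _); rewrite /letter_le /=; clear; lia.
have := ge (z.1 - 1); rewrite hX; move: zX zY; clear.
move: (z.1) => c; move: (H _) (H _) (balance _) => ? ? ? ? ?; lia.
Qed.

End Word.

(** * Sorted sequences *)

Lemma count_lt_nth (T : seq int) (x : int) j : sorted (fun y z : int => y < z) T ->
  (j < count (fun a => (a <= x)%R) T)%N = (j < size T)%N && (nth 0 T j <= x).
Proof.
elim: T j => [|a T IH] j //= so; have so' := path_sorted so.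
have [ax|xa] := leP a x; first by case: j => [|j] //=; rewrite add1n ltnS IH.
have -> : count (fun b => (b <= x)%R) T = 0%N.
  apply/eqP; rewrite -leqn0 leqNgt -has_count; apply/hasPn => b bT; rewrite -ltNge.
  by apply: lt_trans xa (allP (order_path_min lt_trans so) b bT).
rewrite addn0 ltn0; apply/esym/negP => /andP[jT]; apply/negP; rewrite -ltNge.
case: j jT => [|j] //=; rewrite ltnS => jT.
by apply: lt_trans xa (allP (order_path_min lt_trans so) _ (mem_nth 0 jT)).
Qed.

Lemma pointwise_le_count (T1 T2 : seq int) :
  sorted (fun y z : int => y < z) T1 -> sorted (fun y z : int => y < z) T2 -> (size T2 <= size T1)%N ->
  (forall j, (j < size T2)%N -> nth 0 T1 j <= nth 0 T2 j) <->
  (forall x : int, (count (fun a => (a <= x)%R) T2 <= count (fun a => (a <= x)%R) T1)%N).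
Proof.
move=> s1 s2 sz; split=> [h x|h j jT].
  case c : (count _ T2) => [//|j]; have : (j < count (fun a => (a <= x)%R) T2)%N by rewrite c.
  rewrite !count_lt_nth // => /andP[jT le]; rewrite (leq_trans jT sz) /=.
  by apply: le_trans le; apply: h.
have : (j < count (fun a => (a <= nth 0%R T2 j)%R) T2)%N by rewrite count_lt_nth // jT lexx.
by move/leq_trans => /(_ _ (h _)); rewrite count_lt_nth // => /andP[].
Qed.

Lemma last_sort (s : seq int) (x : int) : x \in s -> (forall y, y \in s -> y <= x) ->
  last 0 (sort <=%R s) = x.
Proof.
move=> xs h; have := sort_sorted (@le_total _ int) s; have := mem_sort <=%R s.
case/lastP: (sort _ s) => [|t y] m so; first by rewrite -m in xs.
rewrite last_rcons; apply/eqP; rewrite eq_le h ?andTb; last by rewrite -m mem_rcons mem_head.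
move: xs; rewrite -m mem_rcons inE => /orP[/eqP-> //|xt].
move: so; rewrite (sorted_pairwise le_trans) -cats1 pairwise_cat => /and3P[/allrelP hl _ _].
by apply: hl; rewrite ?mem_head.
Qed.

Lemma head_sort (s : seq int) (x : int) : x \in s -> (forall y, y \in s -> x <= y) ->
  head 0 (sort <=%R s) = x.
Proof.
move=> xs h; have := sort_sorted (@le_total _ int) s; have := mem_sort <=%R s.
case: (sort _ s) => [|y t] m so /=; first by rewrite -m in xs.
apply/eqP; rewrite eq_le h ?andbT; last by rewrite -m mem_head.
move: xs; rewrite -m inE => /orP[/eqP-> //|xt].
exact: (allP (order_path_min le_trans so)).
Qed.

(** * The word of a path, read by rows *)

Section Reading.
Variables (n k : nat) (lam nu : seq nat) (a b : nat) (p : {set 'I_n} * {set 'I_n}).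
Hypotheses (n_gt0 : (0 < n)%N) (lam_res : restricted n k lam) (nu_res : restricted n k nu).
Hypothesis pX : p \in strip_pairs n k lam nu a b.

Local Notation F := (free_rows n lam nu).
Local Notation D := (double_rows n lam nu).
Local Notation I1 := p.1.
Local Notation I2 := p.2.
Local Notation la i := (nth 0%N lam i).
Local Notation nn i := (nth 0%N nu i).

(** The label of the first box added in row [r], with rows numbered from 0; a
    second box has the next label. *)
Definition content (r : nat) : int := (la r)%:Z - r%:Z.
Local Notation g := content.
Definition lower_labels := [seq g r | r <- rows I1].
Definition upper_labels := [seq g r + (inrow I1 r)%:Z | r <- rows I2].
Local Notation H := (excess lower_labels upper_labels).
Local Notation h := (height F (I1 :&: F)).

Let pl : is_part lam. Proof. by case/and3P: lam_res. Qed.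
Let sl : (size lam <= n)%N. Proof. by case/and3P: lam_res. Qed.
Let pn : is_part nu. Proof. by case/and3P: nu_res. Qed.

Lemma row_sum (i : 'I_n) : nn i = (la i + (i \in I1) + (i \in I2))%N.
Proof. by have [_ _ _ _ ->] := strip_pairsP lam_res pX; rewrite !inrowE. Qed.

Lemma freeE (i : 'I_n) : (i \in F) = (i \in I1) (+) (i \in I2).
Proof. by rewrite inE row_sum; case: (i \in I1); case: (i \in I2); clear; lia. Qed.

Lemma doubleE (i : 'I_n) : (i \in D) = (i \in I1) && (i \in I2).
Proof. by rewrite inE row_sum; case: (i \in I1); case: (i \in I2); clear; lia. Qed.

Lemma content_lt i j : (i < j)%N -> g j < g i.
Proof. by move=> ij; rewrite /content; move: ij (part_nth_le pl (ltnW ij)); clear; lia. Qed.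

Lemma content_le i j : (i <= j)%N -> g j <= g i.
Proof. by rewrite leq_eqVlt => /orP[/eqP-> //|/content_lt/ltW]. Qed.

Let count_rows (I : {set 'I_n}) (Q : pred nat) :
  (count Q (rows I))%:Z = \sum_(i < n) (((i \in I) && Q i) : nat)%:Z.
Proof.
rewrite count_filter -sum1_count -[n in iota 0 n]subn0 -/(index_iota 0 n) big_mkcond big_mkord.
rewrite -natz natr_sum; apply: eq_bigr => i _; rewrite /= inrowE andbC.
by case: (_ && _).
Qed.

Lemma excess_sum x : H x = \sum_(i < n) ((((i \in I1) && (g i <= x)) : nat)%:Z
   - (((i \in I2) && (g i + ((i \in I1) : nat)%:Z <= x)) : nat)%:Z).
Proof.
rewrite /excess !count_map !count_rows -sumrB; apply: eq_bigr => i _ /=.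
by rewrite inrowE.
Qed.

Lemma height_sum r : h r = \sum_(i < n | (r <= i)%N) (((i \in I1) : nat)%:Z - ((i \in I2) : nat)%:Z).
Proof.
rewrite /height [RHS](bigID (mem F)) /= [X in _ + X]big1 ?addr0 => [|i /andP[_]].
  apply: eq_big => [i|i /andP[iF _]]; first by rewrite andbC.
  by rewrite in_setI iF andbT; move: iF; rewrite freeE; case: (i \in I1); case: (i \in I2).
by rewrite freeE; case: (i \in I1); case: (i \in I2).
Qed.

(** Rows from [r] upwards are read completely, except that the second box of the
    row [r] is still missing if the first one has label [x].  Lower rows have not
    started, because the contents strictly increase downwards. *)
Lemma excess_height (r : nat) x : (forall i : 'I_n, (g i <= x) = (r <= i)%N) ->
  H x = h r + (if [exists i : 'I_n, [&& i == r :> nat, i \in D & g i == x]] then 1 else 0).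
Proof.
move=> thr; rewrite excess_sum height_sum [in RHS]big_mkcond /=.
case: ifPn => [/existsP[i0 /and3P[/eqP ir iD /eqP gx]]|/existsPn no].
  rewrite (bigD1 i0) //= [in RHS](bigD1 i0) //= -ir leqnn gx lexx.
  move: iD; rewrite doubleE => /andP[-> ->] /=.
  have -> : (x + 1%N%:Z <= x) = false by clear; lia.
  rewrite (eq_bigr (fun i : 'I_n => if (i0 <= i)%N then ((i \in I1) : nat)%:Z - ((i \in I2) : nat)%:Z else 0)) => [|i ne].
    by move: (bigop.body _ _ _) => S; clear; lia.
  rewrite thr -ir; case: ifP => [le|nle]; last first.
    rewrite andbF; case: (i \in I2) => //=; have := thr i; rewrite -ir nle; clear.
    by case: (i \in I1) => /= ; case: leP => //; lia.
  have lt : (i0 < i)%N by rewrite ltn_neqAle le andbT eq_sym.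
  rewrite andbT; case: (i \in I2); rewrite ?andbT ?andbF //=.
  by have := content_lt lt; rewrite gx; clear; case: (i \in I1) => /=; case: leP => //; lia.
rewrite addr0; apply: eq_bigr => i _; have := thr i; case: (leqP r i) => ri gi; last first.
  rewrite gi andbF; case: (i \in I2) => //=; move: gi; clear.
  by case: (i \in I1) => /=; case: leP => //; case: leP => //; lia.
rewrite gi andbT; case i2 : (i \in I2) => //=.
suff -> : g i + ((i \in I1) : nat)%:Z <= x by [].
case i1 : (i \in I1); last by rewrite addr0.
have iD : i \in D by rewrite doubleE i1 i2.
have [e|ne] := eqVneq (i : nat) r.
  by move: gi (no i); rewrite e eqxx iD /=; clear; lia.
have lt : (r < i)%N by rewrite ltn_neqAle eq_sym ne.
have rn : (r < n)%N by apply: ltn_trans lt (ltn_ord i).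
have := thr (Ordinal rn); rewrite /= leqnn; have := content_lt lt; clear; lia.
Qed.

Lemma excess_row (r : 'I_n) : H (g r) = h r + (if r \in D then 1 else 0).
Proof.
rewrite (@excess_height r) => [|i]; last first.
  by apply/idP/idP => [|/content_le //]; rewrite leqNgt; apply: contraL => /content_lt; rewrite -ltNge.
congr (_ + _); congr (if _ then _ else _); apply/existsP/idP => [[i /and3P[/eqP/val_inj -> ? _]] //|rD].
by exists r; rewrite eqxx rD eqxx.
Qed.

Lemma excess_between (r : 'I_n) x : g r < x -> (forall i : 'I_n, (i < r)%N -> x < g i) -> H x = h r.
Proof.
move=> rx lt; rewrite (@excess_height r) => [|i].
  case: existsP => [[i /and3P[/eqP e _ /eqP gx]]|_]; last exact: addr0.
  by move: rx; rewrite -gx e ltxx.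
case: (leqP r i) => ri; first exact: le_trans (content_le ri) (ltW rx).
by apply/negbTE; rewrite -ltNge lt.
Qed.

Lemma excess_low x : (forall i : 'I_n, x < g i) -> H x = 0.
Proof.
move=> lt; rewrite (@excess_height n) => [|i]; last first.
  by rewrite leqNgt ltn_ord; apply/negbTE; rewrite -ltNge.
rewrite height_out //; case: existsP => [[i /and3P[/eqP e _ _]]|_]; last exact: addr0.
by have := ltn_ord i; rewrite e ltnn.
Qed.

Lemma excess_ge x : exists r, [/\ (r <= n)%N, forall i : 'I_n, (g i <= x) = (r <= i)%N & h r <= H x].
Proof.
have ex : exists r, (r == n) || (g r <= x) by exists n; rewrite eqxx.
case: (ex_minnP ex) => r hr rmin.
have rn : (r <= n)%N by apply: rmin; rewrite eqxx.
have thr (i : 'I_n) : (g i <= x) = (r <= i)%N.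
  apply/idP/idP => [gi|ri]; first by apply: rmin; rewrite gi orbT.
  case/orP: hr => [/eqP e|]; last by apply: le_trans; apply: content_le.
  by move: ri; rewrite e leqNgt ltn_ord.
exists r; split=> //; rewrite (excess_height thr).
by move: (h r) => y; case: ifP => _; clear; lia.
Qed.

Lemma height_flat r s : (r <= s)%N -> (forall i : 'I_n, (r <= i < s)%N -> i \notin F) -> h r = h s.
Proof.
move=> rs hn; rewrite /height; apply: eq_bigl => i; case iF : (i \in F) => //=.
case: (leqP s i) => [si|lt]; first by rewrite (leq_trans rs si).
by apply/negbTE/negP => ri; have := hn i; rewrite ri lt iF => /(_ isT).
Qed.

Lemma height_down r s : (r <= s)%N -> (forall i : 'I_n, (r <= i < s)%N -> i \in F -> i \notin I1) -> h r <= h s.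
Proof.
move=> rs hn; rewrite /height [leRHS]big_mkcondr /= [leLHS]big_mkcondr; apply: ler_sum => i iF.
case: (leqP s i) => [si|lt]; first by rewrite (leq_trans rs si).
case: ifP => // ri; rewrite in_setI (negbTE (hn i _ iF)) ?ri ?lt //.
Qed.

(** If a double row [r] lies above a double row in the same column, their letters
    interlace and no label separates them; then descend, which changes neither
    height. *)
Lemma exact_label (r : 'I_n) : exists x, [/\ H x = h r, g r <= x &
  forall j : 'I_n, (j < r)%N -> j \notin D -> x < g j].
Proof.
case: r => r rn; elim: r rn => [|r IH] rn.
  have [rD|rD] := boolP (Ordinal rn \in D).
    exists (g 0 + 1); split=> //; last by rewrite lerDl.
    by rewrite (@excess_between (Ordinal rn)) // ltrDl.
  by exists (g 0); split=> //; have := excess_row (Ordinal rn); rewrite (negbTE rD) addr0.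
have [rD|rD] := boolP (Ordinal rn \in D); last first.
  exists (g r.+1); split=> //; last by move=> j jr _; apply: content_lt.
  by have := excess_row (Ordinal rn); rewrite (negbTE rD) addr0.
have [lt|ge] := ltP (g r.+1 + 1) (g r).
  have hx (j : 'I_n) : (j < r.+1)%N -> g r.+1 + 1 < g j.
    by rewrite ltnS => /content_le; apply: lt_le_trans.
  exists (g r.+1 + 1); split=> // [||j /hx //]; last by rewrite lerDl.
  by rewrite (@excess_between (Ordinal rn)) // ltrDl.
have rn' := ltnW rn; have lE : la r = la r.+1.
  by move: ge (part_nth_le pl (leqnSn r)); rewrite /content; clear; lia.
have r'D : Ordinal rn' \in D.
  have [box _ _ _] := strip_rows lam_res pX.
  move: rD (box (Ordinal rn')) (part_nth_le pn (leqnSn r)); rewrite !inE /= lE.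
  by clear; lia.
have [x [e1 e2 e3]] := IH rn'; exists x; split.
- rewrite e1; apply: height_flat => // i /andP[]; rewrite /= ltnS => h1 h2.
  have -> : i = Ordinal rn' by apply: val_inj; apply/eqP; rewrite eqn_leq h1 h2.
  by move: r'D; rewrite !inE; clear; lia.
- by apply: le_trans e2; apply: content_le.
move=> j; rewrite /= ltnS leq_eqVlt => /orP[/eqP e|lt]; last exact: e3.
by have -> : j = Ordinal rn' by [apply: val_inj]; rewrite r'D.
Qed.

Lemma lattice_excess : lattice F (I1 :&: F) <-> (forall x, 0 <= H x).
Proof.
split=> [/forallP la x|hx].
  have [r [rn _]] := excess_ge x; apply: le_trans.
  by case: (ltnP r n) => [lt|ge]; [apply: (la (Ordinal lt)) | rewrite height_out].
by apply/forallP => r; have [x [<- _ _]] := exact_label r.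
Qed.

Let P := path_of lam p.
Variable mu : seq nat.
Hypotheses (aE : conj_part mu 1 = a) (bE : conj_part mu 2 = b).

Let pX' : p \in strip_pairs n k lam nu (conj_part mu 1) (conj_part mu 2).
Proof. by rewrite aE bE. Qed.

Let v1 : vstrip lam I1. Proof. by have [_ ? _ _ _] := strip_pairsP lam_res pX. Qed.

Lemma labels1E : labels1 lam P = lower_labels.
Proof.
have [_ _ e _] := strips_in_paths lam_res nu_res pX'.
rewrite /labels1 /labels -/(boxes1 lam P) e -map_comp; apply: eq_map => r.
by rewrite /label /content /=; clear; lia.
Qed.

Lemma labels2E : labels2 lam P = upper_labels.
Proof.
have [_ m _ e] := strips_in_paths lam_res nu_res pX'.
rewrite /labels2 /labels -/(boxes2 lam P) e -map_comp; apply: eq_map => r.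
by rewrite /label /content /= nth_add_strip //; move: (nth _ _ _) => x; case: (inrow _ _); clear; lia.
Qed.

Lemma wordE : word lam P = letters lower_labels upper_labels.
Proof. by rewrite /word labels1E labels2E. Qed.

(** Both say that no prefix of the word has more right than left parentheses. *)
Lemma fitsE : (b <= a)%N -> fits lam mu P = lattice F (I1 :&: F).
Proof.
move=> ba; have [inP _ _ _] := strips_in_paths lam_res nu_res pX'.
have [[c1 c2] _ _ _ _] := strip_pairsP lam_res pX.
have /and5P[_ _ /andP[d1 d2] _ _] := inP.
set T1 := rev lower_labels; set T2 := rev upper_labels.
have z1 : size T1 = a by rewrite size_rev size_map size_rows c1.
have z2 : size T2 = b by rewrite size_rev size_map size_rows c2.
have s1 : sorted (fun x y : int => x < y) T1.
  by rewrite rev_sorted -labels1E; exact: d1.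
have s2 : sorted (fun x y : int => x < y) T2.
  by rewrite rev_sorted -labels2E; exact: d2.
rewrite /fits /column_strict /tableau labels1E labels2E /= -/T1 -/T2 z1 z2 aE bE !eqxx s1 s2 /=.
have sz : (size T2 <= size T1)%N by rewrite z1 z2.
have [h1 h2] := pointwise_le_count s1 s2 sz; have [l1 l2] := lattice_excess.
have exE x : (0 <= H x) = (count (fun a => (a <= x)%R) T2 <= count (fun a => (a <= x)%R) T1)%N.
  by rewrite /excess !count_rev subr_ge0.
apply/allP/idP => [al|la].
  apply: l2 => x; rewrite exE; apply: h1 => j; rewrite z2 => jb.
  by apply: al; rewrite mem_iota.
move=> j; rewrite mem_iota add0n => /andP[_ jb]; apply: h2; last by rewrite z2.
by move=> x; rewrite -exE; apply: l1.
Qed.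

Hypothesis k_gt0 : (0 < k)%N.
Local Notation B := (last_column_rows n lam nu).
Let ltl : (n.-1 < n)%N. Proof. by rewrite prednK. Qed.
Let z : 'I_n := Ordinal n_gt0.
Let l : 'I_n := Ordinal ltl.

Lemma upper_label (r : 'I_n) : r \in I2 -> g r + ((r \in I1) : nat)%:Z = (nn r)%:Z - 1 - r%:Z.
Proof. by move=> r2; rewrite (row_sum r) r2 /content; case: (r \in I1); clear; lia. Qed.

Lemma mem_upper x : reflect (exists2 r : 'I_n, r \in I2 & x = (nn r)%:Z - 1 - r%:Z) (x \in upper_labels).
Proof.
apply: (iffP mapP) => [[r]|[r r2 ->]].
  rewrite mem_rows => r2 ->; have rn : (r < n)%N by rewrite ltnNge; apply/negP => /(inrow_out I2); rewrite r2.
  move: r2; rewrite (inrowE I2 (Ordinal rn)) => r2; exists (Ordinal rn) => //.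
  by rewrite -upper_label //= -(inrowE I1 (Ordinal rn)).
by exists (r : nat); rewrite ?mem_rows ?inrowE // upper_label.
Qed.

Lemma mem_lower x : reflect (exists2 r : 'I_n, r \in I1 & x = g r) (x \in lower_labels).
Proof.
apply: (iffP mapP) => [[r]|[r r1 ->]].
  rewrite mem_rows => r1 ->; have rn : (r < n)%N by rewrite ltnNge; apply/negP => /(inrow_out I1); rewrite r1.
  by move: r1; rewrite (inrowE I1 (Ordinal rn)) => r1; exists (Ordinal rn).
by exists (r : nat); rewrite ?mem_rows ?inrowE.
Qed.

Lemma lower_uniq : uniq lower_labels.
Proof.
rewrite map_inj_uniq ?filter_uniq ?iota_uniq // => i j e.
by case: (ltngtP i j) => // /content_lt; rewrite e ltxx.
Qed.

Lemma upper_uniq : uniq upper_labels.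
Proof.
have [_ _ _ e] := strips_in_paths lam_res nu_res pX'; rewrite -labels2E.
have [inP _ _ _] := strips_in_paths lam_res nu_res pX'; have /and5P[_ _ /andP[_ d2] _ _] := inP.
have tr : transitive (fun x y : int => y < x) by move=> ? ? ? h1 h2; apply: lt_trans h2 h1.
by apply: sorted_uniq d2 => // x; apply: ltxx.
Qed.

Lemma mem_col1 c x : x \in [seq label y | y <- boxes1 lam P & y.1 == c] ->
  exists2 r : 'I_n, r \in I1 & (la r).+1 = c /\ x = c%:Z - 1 - r%:Z.
Proof.
have [_ _ e _] := strips_in_paths lam_res nu_res pX'; rewrite e.
case/mapP=> y; rewrite mem_filter => /andP[/eqP yc /mapP[r]]; rewrite mem_rows => r1 ye ->.
have rn : (r < n)%N by rewrite ltnNge; apply/negP => /(inrow_out I1); rewrite r1.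
move: r1; rewrite (inrowE I1 (Ordinal rn)) => r1; exists (Ordinal rn) => //.
by rewrite -yc ye /label /=; split=> //; clear; lia.
Qed.

Lemma mem_col2 c x : reflect (exists2 r : 'I_n, r \in I2 & nn r = c /\ x = c%:Z - 1 - r%:Z)
  (x \in [seq label y | y <- boxes2 lam P & y.1 == c]).
Proof.
have [_ _ _ e] := strips_in_paths lam_res nu_res pX'; rewrite e.
apply: (iffP mapP) => [[y]|[r r2 [rc ->]]].
  rewrite mem_filter => /andP[/eqP yc /mapP[r]]; rewrite mem_rows => r2 ye ->.
  have rn : (r < n)%N by rewrite ltnNge; apply/negP => /(inrow_out I2); rewrite r2.
  move: r2; rewrite (inrowE I2 (Ordinal rn)) => r2; exists (Ordinal rn) => //.
  move: yc; rewrite ye /label /= => yc; split; last by rewrite -yc; clear; lia.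
  have := row_sum (Ordinal rn); rewrite r2 /= => ->; rewrite -yc nth_add_strip //.
  by rewrite -(inrowE I1 (Ordinal rn)) addn1.
exists ((nth 0%N (add_strip lam I1) r).+1, r.+1).
  rewrite mem_filter map_f ?mem_rows ?inrowE // andbT /= nth_add_strip // inrowE -rc row_sum r2.
  by rewrite addn1.
by rewrite /label /= nth_add_strip // inrowE -rc row_sum r2; case: (r \in I1); clear; lia.
Qed.

Lemma in_row1 (r : 'I_n) : in_row r.+1 (boxes1 lam P) = (r \in I1).
Proof.
have [_ _ e _] := strips_in_paths lam_res nu_res pX'; rewrite /in_row e.
rewrite has_map -inrowE -mem_rows; apply/hasP/idP => [[x xr /eqP[<-]] //|rr].
by exists (r : nat) => //=.
Qed.

Lemma in_row2 (r : 'I_n) : in_row r.+1 (boxes2 lam P) = (r \in I2).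
Proof.
have [_ _ _ e] := strips_in_paths lam_res nu_res pX'; rewrite /in_row e.
rewrite has_map -inrowE -mem_rows; apply/hasP/idP => [[x xr /eqP[<-]] //|rr].
by exists (r : nat) => //=.
Qed.

Lemma lattice_top : wraps n k lam nu -> lattice F (I1 :&: F) -> l \in I1.
Proof.
move=> /and3P[_ _ lF] /forallP/(_ l); rewrite (heightS F _ l) height_out; last by rewrite /= prednK.
by rewrite inE lF in_setI; case: (l \in I1).
Qed.

(** A lattice word begins with a left parenthesis, so that [P.1] adds the box in
    the top row as soon as this row is free. *)
Lemma wrapsE : lattice F (I1 :&: F) ->
  wraps n k lam nu = (part nu 1 - part nu n == k)%N && [&& in_row n (boxes1 lam P), ~~ in_row n (boxes2 lam P)
     & in_row 1 (boxes1 lam P) (+) in_row 1 (boxes2 lam P)].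
Proof.
move=> la_; have rowl1 : in_row n (boxes1 lam P) = (l \in I1) by rewrite -in_row1 /= prednK.
have rowl2 : in_row n (boxes2 lam P) = (l \in I2) by rewrite -in_row2 /= prednK.
rewrite rowl1 rowl2 (in_row1 z) (in_row2 z).
have := row_sum z; have := row_sum l; have := part_nth_le pn (leq0n n.-1).
have := lattice_top^~ la_; rewrite /wraps /part /=.
move: (nth 0%N nu 0) (nth 0%N nu n.-1) (nth 0%N lam 0) (nth 0%N lam n.-1) => x y x' y'.
case: (l \in I1); case: (l \in I2); case: (z \in I1); case: (z \in I2) => /=; clear => h1 h2 h3 h4;
  apply/idP/idP => h; move: h h1; rewrite ?andbF ?andbT /=; lia.
Qed.

Lemma mem_col1r (r : 'I_n) : r \in I1 ->
  (la r).+1%:Z - 1 - r%:Z \in [seq label y | y <- boxes1 lam P & y.1 == (la r).+1].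
Proof.
have [_ _ e _] := strips_in_paths lam_res nu_res pX'; rewrite e => r1.
apply/mapP; exists ((la r).+1, r.+1); last by rewrite /label /=; clear; lia.
by rewrite mem_filter eqxx /=; apply: (map_f (fun r => ((la r).+1, r.+1)%N)); rewrite mem_rows inrowE.
Qed.

(** * The last column and the set D_2 *)

Section Wraps.
Hypothesis wr : wraps n k lam nu.
Hypothesis lattice_p : lattice F (I1 :&: F).

Let w0 : nn 0%N = (la 0%N).+1. Proof. by case/and3P: wr => _ /eqP. Qed.
Let h_ge0 (r : 'I_n) : 0 <= h r. Proof. by move/forallP: lattice_p. Qed.

Let BE (r : 'I_n) : r \in B -> [/\ r \in F, la r = la 0%N & nn r = nn 0%N].
Proof.
rewrite inE => /andP[rF /eqP lr]; split=> //.
by move: rF; rewrite inE => /eqP ->; rewrite lr w0.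
Qed.

Let colE (r : 'I_n) : nn r = nn 0%N -> r \in B \/ r \in D /\ (la r).+1 = la 0%N.
Proof.
have [box _ _ _] := strip_rows lam_res pX; have := box r.
rewrite !inE w0 => + e; rewrite e => bx; move: bx (part_nth_le pl (leq0n r)).
move: (la 0%N) (la r) => x y; clear; case: (ltngtP y x) => // [lt|->] h1 h2.
  by right; split; [apply/eqP|]; lia.
by left; rewrite !eqxx.
Qed.

Lemma last_column_rows_down (i j : 'I_n) : (i <= j)%N -> j \in B -> i \in B.
Proof.
move=> ij /BE[jF lj nj]; have li : la i = la 0%N.
  by apply/eqP; rewrite eqn_leq part_nth_le // -lj part_nth_le.
have ni : nn i = nn 0%N.
  by apply/eqP; rewrite eqn_leq part_nth_le // -nj part_nth_le.
by rewrite !inE li ni w0 !eqxx.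
Qed.

Let q : 'I_n := [arg max_(r > z | nn r == nn 0%N) (r : nat)].
Let qE : nn q = nn 0%N /\ forall r : 'I_n, nn r = nn 0%N -> (r <= q)%N.
Proof.
rewrite /q; case: arg_maxnP => [|r /eqP rE h]; first by [].
by split=> // r' e; apply: h; apply/eqP.
Qed.

Let q_down (r : 'I_n) : (r <= q)%N -> nn r = nn 0%N.
Proof.
by move=> rq; apply/eqP; rewrite eqn_leq part_nth_le //= -qE.1 part_nth_le.
Qed.

Let q_up (r : 'I_n) : (q < r)%N -> (nn r < nn 0%N)%N.
Proof.
move=> qr; rewrite ltn_neqAle part_nth_le // andbT; apply/eqP => /(qE.2).
by rewrite leqNgt qr.
Qed.

Let a1E : head 0 (col_labels (part nu 1) (boxes1 lam P ++ boxes2 lam P)) = (nn 0%N)%:Z - 1 - q%:Z.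
Proof.
have [qn qm] := qE.
rewrite /col_labels /part /=; apply: head_sort; rewrite filter_cat map_cat.
  rewrite mem_cat; case: (colE qn) => [qB|[qD _]].
    have [qF lq _] := BE qB; move: qF; rewrite freeE.
    case q1 : (q \in I1) => /= q2.
      by apply/orP; left; rewrite w0 -lq; apply: mem_col1r.
    by apply/orP; right; apply/mem_col2; exists q.
  by apply/orP; right; apply/mem_col2; exists q => //; move: qD; rewrite doubleE => /andP[].
move=> y; rewrite mem_cat => /orP[/mem_col1[r r1 [e ->]]|/mem_col2[r r2 [e ->]]].
  suff /qm : nn r = nn 0%N by clear; lia.
  apply/eqP; rewrite eqn_leq part_nth_le //= -e row_sum r1; clear; lia.
by have := qm r e; clear; lia.
Qed.

Let ai0E (j : 'I_n) : j \in I2 -> nn j = nn 0%N ->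
  (forall r : 'I_n, r \in I2 -> nn r = nn 0%N -> (j <= r)%N) ->
  last 0 (col_labels (part nu 1) (boxes2 lam P)) = (nn 0%N)%:Z - 1 - j%:Z.
Proof.
move=> j2 jn jm; rewrite /col_labels /part /=; apply: last_sort.
  by apply/mem_col2; exists j.
move=> y /mem_col2[r r2 [e ->]]; have := jm r r2 e; clear; lia.
Qed.

Let pairsE : pairs lam P = pairing [::] (letters lower_labels upper_labels).
Proof. by rewrite /pairs wordE. Qed.

Let W := letters lower_labels upper_labels.

Lemma first_upper_row (r0 : 'I_n) : r0 \in I2 -> nn r0 = nn 0%N -> exists j : 'I_n,
  [/\ j \in I2, nn j = nn 0%N & forall r : 'I_n, r \in I2 -> nn r = nn 0%N -> (j <= r)%N].
Proof.
move=> r02 r0n; pose Q (r : 'I_n) := (r \in I2) && (nn r == nn 0%N).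
have Q0 : Q r0 by rewrite /Q r02 r0n eqxx.
case: (@arg_minnP _ r0 Q (fun r : 'I_n => r : nat) Q0) => j /andP[j2 /eqP jn] jm.
by exists j; split=> // r r2 rn; apply: jm; rewrite /Q r2 rn eqxx.
Qed.

(** The boxes of the second strip in the last column then lie in double rows, just
    above the free ones.  Their letters and those of the boxes to their left read
    as a single matched group ( () () ), whose outer letters are a_1 - 1 and a_(i_0). *)
Lemma full_column : B \subset I1 -> col_labels (part nu 1) (boxes2 lam P) != [::] ->
  has (fun xy => (xy.1.1 == head 0 (col_labels (part nu 1) (boxes1 lam P ++ boxes2 lam P)) - 1)
     && (xy.2 == (last 0 (col_labels (part nu 1) (boxes2 lam P)), false))) (pairs lam P).
Proof.
move=> sub ne; have [r0 r02 r0n] : exists2 r : 'I_n, r \in I2 & nn r = nn 0%N.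
  have : has predT (col_labels (part nu 1) (boxes2 lam P)).
    by rewrite has_predT lt0n size_eq0.
  by case/hasP=> x; rewrite mem_sort => /mem_col2[r r2 [rn _]] _; exists r.
have [j [j2 jn jm']] := first_upper_row r02 r0n.
have not2 r : r \in B -> r \notin I2.
  by move=> rB; have [+ _ _] := BE rB; rewrite freeE (subsetP sub r rB); case: (r \in I2).
have [qn qm] := qE.
have jq : (j <= q)%N by apply: qm.
have [jD lj] : j \in D /\ (la j).+1 = la 0%N.
  by case: (colE jn) => // /not2; rewrite j2.
have mid (r : 'I_n) : (j <= r <= q)%N -> r \in D /\ (la r).+1 = la 0%N.
  case/andP=> jr rq; case: (colE (q_down rq)) => // /BE[_ lr _].
  by have := part_nth_le pl jr; rewrite lr -lj ltnn.
have [qD lq] : q \in D /\ (la q).+1 = la 0%N by apply: mid; rewrite jq leqnn.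
have flat (r : 'I_n) : (j <= r <= q)%N -> h r = h q.
  case/andP=> jr rq; apply: height_flat => // i /andP[ri iq].
  have /mid[+ _] : (j <= i <= q)%N by rewrite (leq_trans jr ri) ltnW.
  by rewrite freeE doubleE => /andP[-> ->].
have gm (r : 'I_n) : (j <= r <= q)%N -> g r = (nn 0%N)%:Z - 2 - r%:Z.
  by move=> /mid[_ lr]; rewrite /content w0 -lr; clear; lia.
have gj : g j = (nn 0%N)%:Z - 2 - j%:Z by apply: gm; rewrite leqnn jq.
have gq : g q = (nn 0%N)%:Z - 2 - q%:Z by apply: gm; rewrite leqnn jq.
rewrite a1E (ai0E j2 jn jm') pairsE.
apply/hasP; exists ((g q, true), ((nn 0%N)%:Z - 1 - j%:Z, false)); last first.
  by rewrite /= eqxx andbT gq; apply/eqP; clear; lia.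
have Hq : H (g q) = h q + 1 by rewrite excess_row qD.
apply: (paired_between lower_uniq upper_uniq).
- by apply/mem_lower; exists q => //; move: qD; rewrite doubleE => /andP[].
- apply/mem_upper => -[r r2]; rewrite gq; case: (leqP r q) => rq.
    by rewrite (q_down rq); move: rq; clear; lia.
  by move: rq (q_up rq); clear; lia.
- by apply/mem_upper; exists j; rewrite ?jn.
- by rewrite gq; move: jq; clear; lia.
- move=> x qx xj; rewrite Hq.
  (* Hence [x] is the content of the row [t] steps below row [q]. *)
  have [t tE] : exists t : nat, x = g q + t%:Z.
    by exists `|x - g q|%N; move: qx; move: (g q) => y; clear; lia.
  have tq : (t <= q - j)%N.
    by move: xj jq; rewrite tE gq; clear; lia.
  have rn : (q - t < n)%N by apply: leq_ltn_trans (leq_subr _ _) (ltn_ord q).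
  have bnd : (j <= Ordinal rn <= q)%N by move: tq jq; rewrite /=; clear; lia.
  have -> : x = g (Ordinal rn) by rewrite gm // tE gq /=; move: tq jq; clear; lia.
  by rewrite excess_row (mid _ bnd).1 (flat _ bnd).
rewrite Hq; congr (_ + 1); rewrite (@excess_between j); first by apply: flat; rewrite leqnn jq.
  by rewrite gj; clear; lia.
move=> i ij; have iq : (i <= q)%N by apply: leq_trans (ltnW ij) jq.
case: (colE (q_down iq)) => [iB|[iD _]].
  have [_ li _] := BE iB; rewrite /content li w0; move: ij; clear; lia.
have := jm' i; rewrite (q_down iq); move: iD; rewrite doubleE => /andP[_ ->] /(_ isT erefl).
by rewrite leqNgt ij.
Qed.

Let strip_mono (i j : 'I_n) : (i <= j)%N -> la i = la j -> j \in I1 -> i \in I1.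
Proof.
move=> ij e j1; have := part_nth_le (add_strip_part v1) ij.
by rewrite !nth_add_strip // !inrowE e j1 leq_add2l; case: (i \in I1).
Qed.

Section Open.
Variable j : 'I_n.
Hypotheses (jB : j \in B) (j2 : j \in I2) (j1 : j \notin I1).
Hypothesis jm : forall r : 'I_n, r \in I2 -> nn r = nn 0%N -> (j <= r)%N.

Let jn : nn j = nn 0%N. Proof. by have [] := BE jB. Qed.
Let lj : la j = la 0%N. Proof. by have [] := BE jB. Qed.
Let jq : (j <= q)%N. Proof. by apply: qE.2. Qed.
Let gj : g j = (nn 0%N)%:Z - 1 - j%:Z. Proof. by rewrite /content lj w0; clear; lia. Qed.

Let below_j (i : 'I_n) : (j <= i <= q)%N -> i \in F -> i \notin I1.
Proof.
case/andP=> ji iq iF; case: (colE (q_down iq)) => [/BE[_ li _]|[iD _]]; last first.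
  by move: iD iF; rewrite doubleE freeE => /andP[-> ->].
by apply: contra j1; apply: strip_mono; rewrite // lj li.
Qed.

Let drop_j s : (j < s)%N -> (s <= q.+1)%N -> h j <= h s - 1.
Proof.
move=> js sq; have := heightS F (I1 :&: F) j; have [-> _ _] := BE jB.
rewrite in_setI (negbTE j1) /= => ->; rewrite addrC lerD2r; apply: height_down => // i /andP[ji iS].
by apply: below_j; rewrite ltnW //= -ltnS; apply: leq_trans sq.
Qed.

Let Hj : H (g j) = h j.
Proof. by rewrite excess_row doubleE (negbTE j1) addr0. Qed.

(** If the two letters were paired, the balance would be the same before the first
    and after the second; but row [j] lowers it, and no free row above [j] in the
    last column raises it. *)
Lemma open_column : ~~ has (fun xy => (xy.1.1 == head 0 (col_labels (part nu 1) (boxes1 lam P ++ boxes2 lam P)) - 1)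
     && (xy.2 == (last 0 (col_labels (part nu 1) (boxes2 lam P)), false))) (pairs lam P).
Proof.
rewrite a1E (ai0E j2 jn jm) pairsE -gj; apply/hasPn => -[[x xb] y] xy /=.
apply/negP => /andP[/eqP xE /eqP yE]; rewrite {}yE in xy.
have [u [v [t [e xT _ _ hv]]]] := pairing_splitP xy; rewrite /= in xT; rewrite xT in e xy.
have hu := before_true lower_uniq upper_uniq e.
have e' : W = (u ++ (x, true) :: v) ++ (g j, false) :: t by rewrite /W e -catA.
have := before_false lower_uniq upper_uniq e'; rewrite balance_cat balance_cons hu hv /= Hj.
have [r [rn thr hr]] := excess_ge (x - 1).
have qr : (q < r)%N.
  rewrite ltnNge -thr -ltNge xE /content.
  case: (colE (q_down (leqnn q))) => [/BE[_ -> _]|[_ lq]]; rewrite w0; first by clear; lia.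
  by rewrite -lq; clear; lia.
have flat : h q.+1 = h r.
  apply: height_flat => // i /andP[qi ir]; apply/negP => iF; move: (q_up qi) ir.
  have := thr i; rewrite xE; move: iF; rewrite inE => /eqP ->.
  move=> gi lt; rewrite ltnNge -gi; move: lt qi (part_nth_le pl (leq0n i)).
  by rewrite w0 /content; clear; lia.
have := drop_j (s := q.+1) jq (leqnn _); rewrite flat.
move: hr; move: (h r) (h j) (H _) => a1 a2 a3; clear; lia.
Qed.

Let topE : (label (part nu n, n), true) = (g n.-1, true) :> letter.
Proof.
congr (_, _); have /eqP lF : nn n.-1 == (la n.-1).+1 by case/and3P: wr.
by rewrite /label /part /= lF /content; move: n_gt0; clear; lia.
Qed.

Let H_top : H (g n.-1 - 1) = 0.
Proof.
apply: excess_low => i; have le : (i <= n.-1)%N by rewrite -ltnS prednK.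
by have := content_le le; clear; lia.
Qed.

Let lastE : last 0 (col_labels (part nu 1) (boxes2 lam P)) = g j.
Proof. by rewrite gj; apply: ai0E. Qed.

(** The match of the first letter is where the balance first returns to zero, and
    all letters after a_(i_0) are left parentheses. *)
Lemma top_condition :
  ~~ paired lam P (label (part nu n, n), true)
    || (((label (part nu n, n), true), (last 0 (col_labels (part nu 1) (boxes2 lam P)), false)) \in pairs lam P)
  = [forall r : 'I_n, (r \notin B) ==> (1 <= h r)].
Proof.
rewrite topE lastE /paired pairsE; apply/idP/forallP => [c4 r|all1].
  apply/implyP => rB; rewrite leNgt; apply/negP => hr.
  have {hr} hr : h r = 0 by move: (h_ge0 r) hr; move: (h r) => y; clear; lia.
  have jr : (j < r)%N by rewrite ltnNge; apply: contra rB => /last_column_rows_down; apply.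
  have [x [Hx gx xlt]] := exact_label r.
  have xj : x < g j by apply: xlt => //; rewrite doubleE (negbTE j1).
  have topx : g n.-1 <= x.
    by apply: le_trans gx; apply: content_le; rewrite -ltnS prednK.
  have l1 : l \in I1 by apply: lattice_top.
  have topW : (g n.-1, true) \in W by rewrite mem_letters; apply/mem_lower; exists l.
  case/splitPr eW : _ / topW => [u v].
  have [i [hi _]] := threshold_split lower_uniq upper_uniq eW topx.
  have [y yP] : exists y, ((g n.-1, true), y) \in pairing [::] W.
    rewrite eW; apply: (@pairing_below _ _ _ i) => //; rewrite hi Hx hr H_top; by [].
  have pd : has (fun xy => (xy.1 == (g n.-1, true)) || (xy.2 == (g n.-1, true))) (pairing [::] W).
    by apply/hasP; exists ((g n.-1, true), y); rewrite ?eqxx.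
  move: c4; rewrite -/W pd /= => tP.
  have [u' [v' [t [e _ _ dyck _]]]] := pairing_splitP tP.
  have [i' [hi' le']] := threshold_split lower_uniq upper_uniq e topx.
  have := dyck i'; move: hi'; rewrite takel_cat; last exact: (le' v' (g j, false) t).
  by rewrite Hx hr H_top => ->.
have [pd|//] := boolP (has _ _); rewrite /=.
have [[x y] xyP] := hasP pd => /= /orP[/eqP xE|/eqP yE]; last first.
  by have [u [v [t [_ _]]]] := pairing_splitP xyP; rewrite yE.
rewrite xE in xyP; suff -> : (g j, false) = y by [].
have [u [v [t [e _ yF _ hv]]]] := pairing_splitP xyP.
case: y e yF xyP => y [] // e _ xyP.
have hu := before_true lower_uniq upper_uniq e.
have e' : W = (u ++ (g n.-1, true) :: v) ++ (y, false) :: t by rewrite /W e -catA.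
have := before_false lower_uniq upper_uniq e'; rewrite balance_cat balance_cons hu hv H_top /=.
rewrite add0r addr0 => Hy; have {}Hy : H y = 0 by move: (H y) Hy => Y; clear; lia.
have yW : (y, false) \in W by rewrite e' mem_cat mem_head orbT.
move: yW; rewrite mem_letters => /mem_upper[r r2]; rewrite -(upper_label r2) => yE.
have [s [sn thr hs]] := excess_ge y; rewrite Hy in hs.
have sr : (s <= r)%N by rewrite -thr yE lerDl; case: (r \in I1).
have sn' : (s < n)%N by apply: leq_ltn_trans sr (ltn_ord r).
pose s' := Ordinal sn'.
have sB : s' \in B.
  apply: contraLR hs => sB; have := all1 s'; rewrite sB /= -ltNge.
  by apply: lt_le_trans.
(* If [r] lay above [s], row [r] would be double, and so would row [s], which is
   free. *)
have rs : r = s'.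
  apply: val_inj; apply/eqP; rewrite eqn_leq sr andbT leqNgt; apply/negP => lt'.
  have lt : (s < r)%N := lt'.
  have gle : g s <= g r + ((r \in I1) : nat)%:Z by rewrite -yE (thr s') leqnn.
  have glt : g r < g s := content_lt lt.
  have r1 : r \in I1.
    by apply: contraLR gle => /negbTE ->; rewrite addr0 -ltNge.
  have [sF _ _] := BE sB; move: sF; rewrite inE /= => /eqP sF.
  have := row_sum r; rewrite r1 r2 => rE; have := part_nth_le pn (ltnW lt).
  move: gle glt lt (part_nth_le pl (ltnW lt)); rewrite r1 /content rE sF.
  by clear; lia.
rewrite -rs in sB; have r1 : r \notin I1.
  by have [+ _ _] := BE sB; rewrite freeE r2; case: (r \in I1).
have jr : (j <= r)%N by apply: jm => //; have [] := BE sB.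
congr (_, _); rewrite yE (negbTE r1) addr0; congr g.
apply/eqP; rewrite eqn_leq jr /= leqNgt; apply/negP => jr'.
have rq : (r <= q.+1)%N by apply: leqW; apply: qE.2; have [] := BE sB.
have := drop_j jr' rq; have := h_ge0 j; have := excess_row r.
rewrite doubleE (negbTE r1) addr0; move: Hy; rewrite yE (negbTE r1) addr0 => -> <-.
by move: (h j) => Y; clear; lia.
Qed.

End Open.

End Wraps.

(** The conditions on top and bottom labels say that the last column wraps; the
    third condition says that it has a free box in the second strip; given this,
    the fourth says that the heights above the last column are positive. *)
Lemma in_D2E : (b <= a)%N -> lattice F (I1 :&: F) ->
  in_D2 n k lam mu nu P = excluded k lam nu (I1 :&: F).
Proof.
move=> ba la_; have [inP _ _ _] := strips_in_paths lam_res nu_res pX'.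
have we := wrapsE la_.
rewrite /in_D2 inP fitsE // la_ /= /excluded.
have [wr|nw] := boolP (wraps n k lam nu); last first.
  move: nw; rewrite we; case: (_ == k) => //= /negbTE rows0.
  by move: rows0; case: (in_row n (boxes1 lam P)); case: (in_row n (boxes2 lam P)); case: (_ (+) _).
move: we; rewrite wr => /esym/andP[-> ->]; rewrite !andTb.
have subE : (B \subset I1 :&: F) = (B \subset I1).
  by rewrite subsetI [B \subset F](_ : _ = true) ?andbT //; apply/subsetP => i; rewrite inE => /andP[].
rewrite subE; have [sub|nsub] := boolP (B \subset I1).
  have [-> //|ne] := eqVneq (col_labels (part nu 1) (boxes2 lam P)) [::].
  by rewrite (full_column wr sub ne).
have [r rB r1] := subsetPn nsub.
have r2 : r \in I2.
  by move: rB; rewrite inE freeE (negbTE r1) => /andP[].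
have rn : nth 0%N nu r = nth 0%N nu 0%N.
  case/and3P: wr => _ /eqP w0 _; move: rB; rewrite !inE => /andP[/eqP -> /eqP ->].
  by rewrite w0.
have [j [j2 jn jm]] := first_upper_row r2 rn.
have jB : j \in B by apply: (last_column_rows_down wr (jm r r2 rn)).
have j1 : j \notin I1.
  by move: jB; rewrite inE freeE j2 => /andP[]; case: (j \in I1).
rewrite (open_column wr jB j2 j1 jm) (top_condition wr la_ jB j2 j1 jm) !andbT /=.
suff -> : col_labels (part nu 1) (boxes2 lam P) != [::] by [].
rewrite -size_eq0 size_sort size_eq0.
have : (nth 0%N nu 0%N)%:Z - 1 - j%:Z \in [seq label y | y <- boxes2 lam P & y.1 == part nu 1].
  by apply/mem_col2; exists j.
by case: [seq _ | _ <- _].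
Qed.

End Reading.

(** * The theorem *)

Theorem theorem12 (n k : nat) (lam mu nu : seq nat)
    (n_gt0 : (0 < n)%N) (k_gt0 : (0 < k)%N)
    (lam_res : restricted n k lam) (mu_res : restricted n k mu)
    (nu_res : restricted n k nu)
    (mu_two_columns : part mu 1 = 2%N) (mu_short : (size mu < n)%N) :
  exists2 m : nat,
    has_card (fusion_path n k lam mu nu) m
  & fusion_coef n k lam mu nu = m%:R.
Proof.
have /and3P[mu_part _ _] := mu_res.
set a := conj_part mu 1; set b := conj_part mu 2.
have ba : (0 < b <= a)%N.
  rewrite conj_partE // -[nth _ _ _]/(part mu 1) mu_two_columns /=.
  by rewrite /a /b /conj_part; apply: sub_count => x; apply: ltnW.
have /andP[_ ba'] := ba.
pose S := [set p in strip_pairs n k lam nu a b |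
  lattice (free_rows n lam nu) (p.1 :&: free_rows n lam nu)
    && ~~ excluded k lam nu (p.1 :&: free_rows n lam nu)].
exists #|S|; last first.
  rewrite fusion_coef_strips // -/a -/b (strip_pairs_diff n_gt0 k_gt0 lam_res nu_res ba).
  by rewrite natrD addrC addKr.
exists [seq path_of lam p | p <- enum S]; split; last by rewrite size_map -cardE.
  rewrite map_inj_in_uniq ?enum_uniq // => p q; rewrite !mem_enum.
  move=> /setIdP[pX _] /setIdP[qX _]; apply: (path_of_inj lam_res nu_res pX qX).
move=> P; rewrite [RHS]unfold_in /fusion_path; apply/mapP/and3P.
  case=> p; rewrite mem_enum => /setIdP[pX /andP[la ex]] ->.
  have [inP _ _ _] := strips_in_paths lam_res nu_res pX.
  by rewrite inP (fitsE lam_res nu_res pX) // (in_D2E n_gt0 lam_res nu_res pX).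
case=> /in_paths_strips[p pX ->] fP dP; exists p => //.
rewrite mem_enum; apply/setIdP; split=> //; have la : lattice (free_rows n lam nu) (p.1 :&: free_rows n lam nu).
  by rewrite -(fitsE lam_res nu_res pX (mu := mu)).
by rewrite la -(in_D2E n_gt0 lam_res nu_res pX (mu := mu)).
Qed.
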